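(* Let $m\geq 2$ and $N>2m$ be integers. Given any real numbers $(a_k)_{0\leq k\leq m-2}$, there exists $\beta\in\mathbb{R}$ such that for every $a_{m-1}\leq\beta$ the radial solution $u$ of the initial value problem $$ \begin{cases} (-\Delta)^m u=e^u,\\ u^{(2k+1)}(0)=0 & \text{for all } 0\leq k\leq m-1,\\ \Delta^k u(0)=a_k & \text{for all } 0\leq k\leq m-1, \end{cases} $$ is stable in $\mathbb{R}^N$.
   Context: Radial functions on $\mathbb{R}^N$ are written $u(x)=u(r)$ with $r=|x|$, and the Laplacian acts on them by $\Delta u=r^{1-N}(r^{N-1}u')'$. The solution of the initial value problem is the smooth radial solution, considered on its maximal interval of existence; saying that it is stable in $\mathbb{R}^N$ means that it is defined on all of $\mathbb{R}^N$ and is stable there in the following sense. A solution $u$ of $(-\Delta)^m u=e^u$ in $\mathbb{R}^N$ is called stable in $\mathbb{R}^N$ if, for every $\phi\in C_0^\infty(\mathbb{R}^N)$, $$\int_{\mathbb{R}^N}|\nabla(\Delta^{\frac{m-1}{2}}\phi)|^2\,dx-\int_{\mathbb{R}^N}e^u\phi^2\,dx\geq 0\quad\text{when } m \text{ is odd},$$ $$\int_{\mathbb{R}^N}|\Delta^{\frac{m}{2}}\phi|^2\,dx-\int_{\mathbb{R}^N}e^u\phi^2\,dx\geq 0\quad\text{when } m \text{ is even}.$$ *)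

(* Defs.v *)
From HB Require Import structures.
From mathcomp Require Import all_boot all_order all_algebra.
From mathcomp Require Import all_classical all_reals all_analysis.

Set Implicit Arguments.
Unset Strict Implicit.
Unset Printing Implicit Defensive.

Import Order.TTheory GRing.Theory Num.Theory.
Import numFieldNormedType.Exports.

Local Open Scope classical_set_scope.
Local Open Scope ring_scope.

(* The Lebesgue measure of R^n is built by recursion on n as the image of the
   library's product measure on R * R^n under (t, x) |-> t :: x. *)
Section lebesgue_measure_cons.
Local Open Scope ereal_scope.
Context (R : realType) (n : nat).
Local Notation RR := (measurableTypeR R).
Variable mu : {sigma_finite_measure set (n.-tuple RR) -> \bar R}.

Definition tuple_cons (p : RR * n.-tuple RR) : n.+1.-tuple RR :=
  cons_tuple p.1 p.2.

Lemma measurable_tuple_cons : measurable_fun [set: RR * n.-tuple RR] tuple_cons.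
Proof. exact: measurable_cons. Qed.

Definition lebesgue_measure_cons : set (n.+1.-tuple RR) -> \bar R :=
  pushforward (@lebesgue_measure R \x mu) tuple_cons.

Let measurable_preimage (A : set (n.+1.-tuple RR)) :
  measurable A -> measurable (tuple_cons @^-1` A).
Proof.
by move=> mA; rewrite -[X in measurable X]setTI; exact: measurable_tuple_cons.
Qed.

Let lebesgue_measure_cons0 : lebesgue_measure_cons set0 = 0.
Proof. by rewrite /lebesgue_measure_cons /pushforward preimage_set0 measure0. Qed.

Let lebesgue_measure_cons_ge0 A : 0 <= lebesgue_measure_cons A.
Proof. by rewrite /lebesgue_measure_cons /pushforward; exact: measure_ge0. Qed.

Let lebesgue_measure_cons_sigma_additive :
  semi_sigma_additive lebesgue_measure_cons.
Proof.
move=> F mF tF mUF; rewrite /lebesgue_measure_cons /pushforward preimage_bigcup.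
apply: measure_semi_sigma_additive.
- by move=> k; exact: measurable_preimage.
- apply/trivIsetP => /= i j _ _ ij; rewrite -preimage_setI.
  by move/trivIsetP : tF => /(_ _ _ _ _ ij) ->//; rewrite preimage_set0.
- by rewrite -preimage_bigcup; exact: measurable_preimage.
Qed.

HB.instance Definition _ := isMeasure.Build _ _ _ lebesgue_measure_cons
  lebesgue_measure_cons0 lebesgue_measure_cons_ge0
  lebesgue_measure_cons_sigma_additive.

Let lebesgue_measure_cons_sigma_finite :
  sigma_finite [set: n.+1.-tuple RR] lebesgue_measure_cons.
Proof.
pose uncons (x : n.+1.-tuple RR) : RR * n.-tuple RR :=
  (thead x, [tuple of behead x]).
have consK x : tuple_cons (uncons x) = x by rewrite [RHS]tuple_eta.
have unconsK p : uncons (tuple_cons p) = p.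
  by case: p => t x; congr pair; apply: val_inj.
have muncons : measurable_fun [set: n.+1.-tuple RR] uncons.
  by apply: measurable_fun_pair; [exact: measurable_tnth|exact: measurable_behead].
have /sigma_finiteP[F [FT ndF Foo]] := sigma_finiteT (@lebesgue_measure R).
have /sigma_finiteP[G [GT ndG Goo]] := sigma_finiteT mu.
exists (fun k => uncons @^-1` (F k `*` G k)).
  rewrite -preimage_bigcup -[LHS](preimage_setT uncons); congr (_ @^-1` _).
  rewrite -setXTT FT GT predeqE => -[t x]; split.
    move=> [/= [k _ Fkt] [l _ Glx]]; exists (maxn k l) => //; split.
    - by move: t Fkt; exact/subsetPset/ndF/leq_maxl.
    - by move: x Glx; exact/subsetPset/ndG/leq_maxr.
  by move=> [k _ []/= ? ?]; split; exists k.
move=> k; have [mF Fk] := Foo k; have [mG Gk] := Goo k; split.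
  by rewrite -[X in measurable X]setTI; apply: muncons => //; exact: measurableX.
rewrite /lebesgue_measure_cons /pushforward -comp_preimage.
rewrite (_ : uncons \o tuple_cons = id) ?preimage_id; last exact/funext.
by rewrite product_measure1E// lte_mul_pinfty// ge0_fin_numE.
Qed.

HB.instance Definition _ := Measure_isSigmaFinite.Build _ _ _
  lebesgue_measure_cons lebesgue_measure_cons_sigma_finite.

End lebesgue_measure_cons.

Section lebesgue_measure_tuple.
Context (R : realType).
Local Notation RR := (measurableTypeR R).

Fixpoint lebesgue_measure_tuple (n : nat) :
    {sigma_finite_measure set (n.-tuple RR) -> \bar R} :=
  match n with
  | 0 => \d_([tuple] : 0.-tuple RR)
  | k.+1 => lebesgue_measure_cons (lebesgue_measure_tuple k)
  end.

End lebesgue_measure_tuple.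

Section calculus.
Context (R : realType) (N : nat).
Implicit Types (f u phi : 'rV[R]_N -> R) (x : 'rV[R]_N) (i : 'I_N).

Definition integral_rV f : R :=
  (\int[lebesgue_measure_tuple R N]_x f (\row_i tnth x i))%R.

(* The library norm of 'rV[R]_N is the sup norm. *)
Definition enorm x : R := Num.sqrt (\sum_i x 0 i ^+ 2).

Definition partial i f : 'rV[R]_N -> R := 'D_(delta_mx 0 i) f.

Definition gradient f x : 'rV[R]_N := \row_i partial i f x.

Definition laplacian f x : R := \sum_i partial i (partial i f) x.

(* Meant for open A: partial derivatives of all orders exist and are continuous
   at each point of A. *)
Definition smooth_on (A : set 'rV[R]_N) f : Prop :=
  forall (s : seq 'I_N) x, A x ->
    {for x, continuous (foldr partial f s)} /\
    forall i, derivable (foldr partial f s) x (delta_mx 0 i).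

Definition test_function phi : Prop :=
  smooth_on setT phi /\ compact (closure [set x | phi x != 0]).

Definition stable (m : nat) u : Prop :=
  forall phi, test_function phi ->
    if odd m then
      0 <= integral_rV (fun x =>
             enorm (gradient (iter (m.-1)./2 laplacian phi) x) ^+ 2)
           - integral_rV (fun x => expR (u x) * phi x ^+ 2)
    else
      0 <= integral_rV (fun x => iter m./2 laplacian phi x ^+ 2)
           - integral_rV (fun x => expR (u x) * phi x ^+ 2).

End calculus.

Section radial_solutions.
Context (R : realType) (N m : nat) (a : 'I_m.-1 -> R) (b : R).
Implicit Types (T : \bar R) (u v : R -> R).

Definition radial u : 'rV[R]_N -> R := fun x => u (enorm x).

Definition eball T : set 'rV[R]_N := [set x | ((enorm x)%:E < T)%E].

(* u is a profile on [0, T): its values elsewhere are irrelevant.  The odd order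
   derivatives at 0 are those of the even extension of u, that is, of the
   restriction of the radial function to a line through the origin. *)
Definition radial_solution T u : Prop :=
  [/\ (0 < T)%E,
      smooth_on (eball T) (radial u),
      forall x, eball T x ->
        iter m (fun f y => - laplacian f y) (radial u) x = expR (radial u x),
      forall k, (k < m)%N -> derive1n k.*2.+1 (fun r : R => u `|r|) 0 = 0 &
      (forall k : 'I_m.-1, iter k (@laplacian R N) (radial u) 0 = a k) /\
      iter m.-1 (@laplacian R N) (radial u) 0 = b].

Definition maximal_radial_solution T u : Prop :=
  radial_solution T u /\
  forall T' v, radial_solution T' v -> (T <= T')%E ->
    (forall r : R, 0 <= r -> (r%:E < T)%E -> v r = u r) -> T' = T.

End radial_solutions.

(* Main.v *)
From HB Require Import structures.
Require Import Defs.
From mathcomp Require Import all_boot all_order all_algebra.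
From mathcomp Require Import all_classical all_reals all_analysis.
From mathcomp Require Import measurable_realfun ring lra zify.

(** Write w(r) for a radial profile, A for the radial Laplacian and B for its
    inverse with B g (0) = (B g)'(0) = 0, which is positive and linear. The
    initial value problem says that u is a fixed point of
      u = sum_(k < m) a_k B^k 1 + (-1)^m B^m (e^u),   a_(m-1) = b.

    Existence and decay. If b is very negative, the Cauchy data alone give a
    polynomial with leading term a negative multiple of |b| r^(2m-2). Suppose
    that K bounds B (e^W), where W is the polynomial obtained with b + K in
    place of b; then any fixed point in which e^u is replaced by e^(min(u, W))
    satisfies u <= W, whatever the parity of m, because
    (-1)^m B^m (e^(min(u, W))) <= B^(m-1) K. So the truncation is inactive and u
    solves the problem on the whole space. The truncated nonlinearity is
    Lipschitz, and B multiplies e^(lam r^2) by a factor at most 1/(2 lam), so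
    its fixed point is found by a contraction in that weighted norm
    ([truncated_fixed_point]). As r^(2m-2) is unbounded (m >= 2), taking b
    very negative forces e^W <= (eps + r^2)^(-m) for a fixed eps > 0,
    and this in turn bounds B (e^W) by comparison with (eps + r^2)^(-1), whose
    Laplacian is negative when N > 4 ([radial_potential_power_bound], [global_profile]).

    Smoothness at the origin. Profiles are differentiated as f' = r g with g
    again an even profile; B gains one such derivative, so the fixed point has
    all of them, and f(|x|) is then smooth since the i-th partial derivative of
    f(|x|) is x_i g(|x|) ([radial_smooth]).

    Uniqueness. The iterated Laplacians of any radial solution are radial on its
    ball and linked by the operator A, so the same weighted contraction shows
    that it agrees with the global profile ([radial_solution_unique]). Hence a
    maximal solution is the global one.

    Stability. With q = (eps + |x|^2)^(-1), integrating the divergence of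
    w q^a grad w + a w^2 q^(a+1) x gives
      int w^2 q^(a+1) <= int (Delta w)^2 q^(a-1)   if N >= 2a + 3, a >= 1,
    and the field w^2 q x gives int w^2 q <= int |grad w|^2. Iterating from
    q^m down, which needs exactly N > 2m, yields
    int phi^2 q^m <= the quadratic form of the statement
    ([rellich_iter], [hardy_step]), and e^u <= q^m concludes. *)

Set Implicit Arguments.
Unset Strict Implicit.
Unset Printing Implicit Defensive.

Import Order.TTheory GRing.Theory Num.Theory.
Import numFieldNormedType.Exports.

Local Open Scope classical_set_scope.
Local Open Scope ring_scope.

(** * Derivatives and primitives *)

Section pointwise_derivatives.
Context (R : realType) (V : normedModType R).
Implicit Types (f g : V -> R) (x v : V).

Lemma is_derive_add f g x v df dg : is_derive x v f df -> is_derive x v g dg ->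
  is_derive x v (fun y => f y + g y) (df + dg).
Proof. exact: is_deriveD. Qed.

Lemma is_derive_sub f g x v df dg : is_derive x v f df -> is_derive x v g dg ->
  is_derive x v (fun y => f y - g y) (df - dg).
Proof. exact: is_deriveB. Qed.

Lemma is_derive_mul f g x v df dg : is_derive x v f df -> is_derive x v g dg ->
  is_derive x v (fun y => f y * g y) (df * g x + f x * dg).
Proof.
move=> df' dg'; apply: (@is_derive_eq _ _ _ (f * g)).
by rewrite /GRing.scale /= addrC mulrC.
Qed.

Lemma is_derive_cmul f x v df (c : R) : is_derive x v f df ->
  is_derive x v (fun y => c * f y) (c * df).
Proof. exact: is_deriveZ. Qed.

Lemma is_derive_const x v (c : R) : is_derive x v (fun=> c) (0 : R).
Proof. exact: is_derive_cst. Qed.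

Lemma is_derive_exprn f x v df n : is_derive x v f df ->
  is_derive x v (fun y => f y ^+ n) (n%:R * f x ^+ n.-1 * df).
Proof.
move=> df'; have -> : (fun y => f y ^+ n) = f ^+ n.
  by apply/funext => y; rewrite exprfctE.
exact: is_deriveX.
Qed.

Lemma is_derive_inv f x v df : f x != 0 -> is_derive x v f df ->
  is_derive x v (fun y => (f y)^-1) (- df / f x ^+ 2).
Proof.
move=> fx0 [dfx <-]; apply: DeriveDef; first exact: derivableV.
by rewrite deriveV // /GRing.scale /= mulrC mulrN mulNr.
Qed.

End pointwise_derivatives.

Section one_variable.
Context (R : realType).
Implicit Types (f g h : R -> R) (x y z : R) (k n : nat).

Lemma is_derive_continuous f x df : is_derive x 1 f df -> {for x, continuous f}.
Proof. by move=> [/derivable1_diffP /differentiable_continuous]. Qed.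

Lemma is_derive_powX x n : is_derive x (1 : R) (fun y => y ^+ n) (n%:R * x ^+ n.-1).
Proof.
apply: is_derive_eq; first exact: (is_derive_exprn n (is_derive_id x (1 : R))).
by rewrite mulr1.
Qed.

(** Only continuity is asked at the endpoints: in radial equations the derivative
    is known on the open interval only. *)
Lemma derive_ge0_le f df (a b : R) : a <= b ->
  (forall x, a < x < b -> is_derive x 1 f (df x)) ->
  (forall x, a <= x <= b -> {for x, continuous f}) ->
  (forall x, a < x < b -> 0 <= df x) -> f a <= f b.
Proof.
move=> ab dfx cf df0; case: (ltgtP a b) ab => // [ab _|-> //].
have [c cab e] : exists2 c, c \in `]a, b[%R & f b - f a = df c * (b - a).
  apply: MVT => //.
  apply: continuous_in_subspaceT => x; rewrite inE /= in_itv /=.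
  exact: cf.
rewrite -subr_ge0 e mulr_ge0 ?subr_ge0 ?(ltW ab) // df0 //.
Qed.

Lemma mean_value0 f df y : (forall x, is_derive x 1 f (df x)) ->
  exists2 c, `|c| <= `|y| & f y - f 0 = df c * y.
Proof.
move=> fd.
have cf (a b : R) : {within `[a, b], continuous f}.
  by apply: continuous_subspaceT => x; exact: is_derive_continuous.
have [y0|y0|->] := ltgtP y 0; last by exists 0 => //; rewrite mulr0 subrr.
- have [c /[!in_itv]/= /andP[yc c0] e] := MVT y0 (fun x _ => fd x) (cf _ _).
  exists c; first by rewrite !ltr0_norm // lerN2 ltW.
  by move: e; rewrite sub0r mulrN => /eqP; rewrite -eqr_oppLR opprB => /eqP.
- have [c /[!in_itv]/= /andP[c0 cy] e] := MVT y0 (fun x _ => fd x) (cf _ _).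
  exists c; first by rewrite !gtr0_norm // ltW.
  by rewrite e subr0.
Qed.

Lemma derive_ext_eq f g h : (forall x, is_derive x 1 f (h x)) ->
  (forall x, is_derive x 1 g (h x)) -> f 0 = g 0 -> f = g.
Proof.
move=> fd gd e0; apply/funext => x; apply/eqP; rewrite -subr_eq0; apply/eqP.
have d0 y : is_derive y 1 (fun x => f x - g x) 0.
  by apply: is_derive_eq (is_derive_sub (fd y) (gd y)) _; rewrite subrr.
by have /= -> := is_derive_0_is_cst x 0 d0; rewrite e0 subrr.
Qed.

(** How averages are differentiated at 0, where they are defined by a limit value. *)
Lemma quadratic_is_derive0 f (C : R) :
  (forall y, `|y| <= 1 -> `|f y - f 0| <= C * y ^+ 2) -> is_derive (0 : R) 1 f 0.
Proof.
move=> fC.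
have C0 : 0 <= C.
  by have := fC 1; rewrite normr1 expr1n mulr1 lexx => /(_ isT) /(le_trans _); apply.
suff l : h^-1 *: ((f \o shift 0) (h *: 1) - f 0) @[h --> (0 : R)^'] --> (0 : R).
  by apply: DeriveDef; [apply/cvg_ex; exists 0 | exact/cvg_lim].
apply/cvgr0Pnorm_le => e e0; near=> h.
have h0 : h != 0 by near: h; exact: nbhs_dnbhs_neq.
have hn0 : 0 < `|h| by rewrite normr_gt0.
have h1 : `|h| <= 1 by near: h; apply: dnbhs0_le.
have he : `|h| <= e / (C + 1).
  by near: h; apply: dnbhs0_le; rewrite divr_gt0 // ltr_wpDl.
rewrite /= /GRing.scale /= mulr1 addr0 normrM normfV mulrC ler_pdivrMr //.
apply: (le_trans (fC _ h1)); rewrite -real_normK ?num_real // expr2 mulrA.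
rewrite ler_wpM2r ?(ltW hn0) // (le_trans (ler_wpM2l C0 he)) //.
by rewrite mulrCA ler_piMr ?(ltW e0) // ler_pdivrMr ?mul1r ?lerDl // ltr_wpDl.
Unshelve. all: by end_near. Qed.

(** The integral from - n.+1 to x differentiates to h for x > - n.+1; normalising
    these functions at 0 makes them coincide. *)
Lemma primitive_exists h : continuous h ->
  exists H, H 0 = 0 /\ forall x, is_derive x 1 H (h x).
Proof.
move=> ch.
pose I (n : nat) x : R :=
  (\int[lebesgue_measure]_(t in `[(- n.+1%:R : R), x]) h t)%R.
have dI n x : - n.+1%:R < x -> is_derive x 1 (I n) (h x).
  move=> nx; suff [d e] : derivable (I n) x 1 /\ derive1 (I n) x = h x.
    by apply: DeriveDef; [exact: d | rewrite -(derive1E (I n) x); exact: e].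
  apply: (@continuous_FTC1_closed R h (- n.+1%:R) x (x + 1)).
  - by rewrite ltrDl.
  - apply: continuous_compact_integrable; first exact: segment_compact.
    exact: continuous_subspaceT.
  - by [].
  - exact: ch.
pose F n x := I n x - I n 0.
have dF n x : - n.+1%:R < x -> is_derive x 1 (F n) (h x).
  move=> /dI d; apply: is_derive_eq (is_derive_sub d (is_derive_const _ _ _)) _.
  by rewrite subr0.
have FE n p x : - n.+1%:R < x -> - p.+1%:R < x -> F n x = F p x.
  move=> nx px; apply/eqP; rewrite -subr_eq0; apply/eqP.
  pose G x := F n x - F p x.
  have G0 : G 0 = 0 by rewrite /G /F !subrr.
  have dG z : Num.min x 0 <= z -> is_derive z 1 G 0.
    rewrite ge_min => /orP zx.
    have [nz pz] : - n.+1%:R < z /\ - p.+1%:R < z.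
      case: zx => zx; first by split; exact: lt_le_trans zx.
      by split; apply: lt_le_trans zx; rewrite oppr_lt0.
    apply: is_derive_eq (is_derive_sub (dF _ _ nz) (dF _ _ pz)) _.
    by rewrite subrr.
  have mono (s : R) a b : a <= b -> Num.min x 0 <= a -> s * G a <= s * G b.
    move=> ab xa; apply: (@derive_ge0_le (fun z => s * G z) (fun=> s * 0)) => //.
    - by move=> z /andP[az _]; apply/is_derive_cmul/dG/(le_trans xa)/ltW.
    - move=> z /andP[az _]; apply: is_derive_continuous (is_derive_cmul s _).
      exact/dG/(le_trans xa).
    - by move=> z _; rewrite mulr0.
  rewrite -/(G x); have [x0|x0] := leP x 0.
    have := mono 1 x 0 x0; have := mono (-1) x 0 x0; rewrite G0.
    rewrite ge_min lexx => /(_ isT) + /(_ isT); lra.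
  have := mono 1 0 x (ltW x0); have := mono (-1) 0 x (ltW x0); rewrite G0.
  rewrite ge_min lexx orbT => /(_ isT) + /(_ isT); lra.
(* F n and F p agree where both are primitives of h, so they glue together. *)
exists (fun x => F (Num.trunc `|x|) x); split; first by rewrite /F subrr.
have truncP x : - (Num.trunc `|x|).+1%:R < x.
  by rewrite ltrNl (le_lt_trans _ (truncnS_gt _)) // -normrN ler_norm.
move=> x; apply: (@near_eq_is_derive _ _ _ (F (Num.trunc `|x|))); last first.
  exact: dF.
near=> y; apply: FE => //.
near: y; exact: (lt_nbhsr (truncP x)).
Unshelve. all: by end_near. Qed.

Definition primitive h : R -> R :=
  xget (cst 0) [set H | H 0 = 0 /\ forall x, is_derive x 1 H (h x)].

Lemma primitiveP h : continuous h ->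
  primitive h 0 = 0 /\ forall x, is_derive x 1 (primitive h) (h x).
Proof.
move=> /primitive_exists[H HP]; rewrite /primitive.
by case: xgetP => [_ -> //|/(_ H)].
Qed.

Lemma primitive0 h : continuous h -> primitive h 0 = 0.
Proof. by move=> /primitiveP[]. Qed.

Lemma is_derive_primitive h x : continuous h -> is_derive x 1 (primitive h) (h x).
Proof. by move=> /primitiveP[]. Qed.

End one_variable.

(** * Weighted averages of even functions *)

Section averages.
Context (R : realType).
Implicit Types (f g h : R -> R) (x y z : R) (k n : nat).

Definition even_fun f := forall y, f (- y) = f y.

(** This is the integral of t^k g(t y) over t in [0, 1]. For k = N - 1, the radial
    function with Laplacian g has derivative y times this average. *)
Definition average k g y : R :=
  if y == 0 then g 0 / k.+1%:R
  else primitive (fun z => z ^+ k * g z) y / y ^+ k.+1.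

Lemma continuous_powM k g : continuous g -> continuous (fun z : R => z ^+ k * g z).
Proof.
move=> cg z; apply: (@continuousM _ _ (fun z => z ^+ k) g); last exact: cg.
exact: exprn_continuous.
Qed.

Global Arguments continuous_powM k {g} _ _.

Lemma averageE k g y : continuous g ->
  y ^+ k.+1 * average k g y = primitive (fun z => z ^+ k * g z) y.
Proof.
move=> cg; rewrite /average; have [->|y0] := eqVneq y 0.
  by rewrite expr0n mul0r primitive0 //; exact: continuous_powM.
by rewrite mulrCA divff ?mulr1 // expf_neq0.
Qed.

Lemma primitive_parity h (s : R) y : continuous h ->
  (forall z, h (- z) = s * h z) -> primitive h (- y) = - s * primitive h y.
Proof.
move=> ch hs; pose F z := primitive h (- z); pose G z := - s * primitive h z.
rewrite -/(F y) -/(G y); congr (_ y).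
apply: (@derive_ext_eq _ _ _ (fun z => - s * h z)) => [z|z|].
- apply: is_derive_eq; first apply: (@is_derive1_comp _ _ (-%R)).
    exact: is_derive_primitive.
  by rewrite hs mulrN1 mulNr.
- exact/is_derive_cmul/is_derive_primitive.
- by rewrite /F /G oppr0 primitive0 // mulr0.
Qed.

Lemma even_average k g : continuous g -> even_fun g -> even_fun (average k g).
Proof.
move=> cg eg y; rewrite /average oppr_eq0; case: ifP => // y0.
have ek z : (- z) ^+ k * g (- z) = (-1) ^+ k * (z ^+ k * g z).
  by rewrite eg (exprNn z) mulrA.
rewrite (primitive_parity _ (continuous_powM k cg) ek).
rewrite (exprNn y) (exprS (-1)); move: (signr_eq0 R k) (expf_eq0 y k.+1).
rewrite y0 andbF => /negbT + /negbT; move: (_ ^+ k) (y ^+ _) => s Y s0 Y0.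
by field; rewrite Y0.
Qed.

(** The primitive of z^k (g z - g 0) is y^(k+1) times the left-hand difference; the
    mean value theorem bounds it. *)
Lemma average_mean_value k g y : continuous g -> y != 0 ->
  exists2 c, `|c| <= `|y| & `|average k g y - average k g 0| <= `|g c - g 0|.
Proof.
move=> cg y0.
pose F z := primitive (fun z => z ^+ k * g z) z - g 0 / k.+1%:R * z ^+ k.+1.
have dF z : is_derive z 1 F (z ^+ k * (g z - g 0)).
  have ck := continuous_powM k cg.
  apply: is_derive_eq (is_derive_sub (is_derive_primitive _ ck)
     (is_derive_cmul _ (is_derive_powX _ _))) _.
  by rewrite /= mulrBr mulrA divfK ?pnatr_eq0 // (mulrC (g 0)).
have [c cy e] := mean_value0 y dF; exists c => //.
have {e} : y ^+ k.+1 * (average k g y - average k g 0) = c ^+ k * (g c - g 0) * y.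
  rewrite -e /F primitive0; last exact: continuous_powM.
  rewrite expr0n mulr0 subr0 subr0 mulrBr averageE //.
  by rewrite /average eqxx [X in _ - X]mulrC.
move=> /(congr1 (fun t => `|t|)); rewrite !normrM !normrX => e.
have yk : 0 < `|y| ^+ k.+1 by rewrite exprn_gt0 ?normr_gt0.
rewrite -(ler_pM2l yk) e mulrAC exprSr ler_wpM2r // ler_wpM2r //.
exact: lerXn2r.
Qed.

Lemma is_derive_average_neq0 k g y : continuous g -> y != 0 ->
  is_derive y 1 (average k g) ((g y - k.+1%:R * average k g y) / y).
Proof.
move=> cg y0; have ck := continuous_powM k cg.
apply: (@near_eq_is_derive _ _ _
  (fun y => primitive (fun z => z ^+ k * g z) y * (y ^+ k.+1)^-1)).
  near=> z; rewrite /average ifF //; apply/negbTE.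
  near: z; exact: open_nbhs_nbhs.
apply: is_derive_eq (is_derive_mul (is_derive_primitive _ ck)
  (is_derive_inv _ (is_derive_powX _ _))) _; first by rewrite expf_neq0.
rewrite -averageE //=; have yk : y ^+ k != 0 by rewrite expf_neq0.
by rewrite exprS; field; rewrite y0.
Unshelve. all: by end_near. Qed.

Lemma continuous_average k g : continuous g -> continuous (average k g).
Proof.
move=> cg y; have [->|y0] := eqVneq y 0; last first.
  exact: is_derive_continuous (is_derive_average_neq0 _ cg y0).
apply/cvgrPdist_le => e e0.
have /cvgrPdist_le /(_ e e0) /nbhs_ballP[d /= d0 gd] := cg 0.
apply/nbhs_ballP; exists d => //= z; rewrite /ball /= sub0r normrN => zd.
rewrite distrC; have [->|z0] := eqVneq z 0; first by rewrite subrr normr0 ltW.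
have [c cz] := average_mean_value k cg z0; move=> /le_trans; apply.
by rewrite distrC; apply: gd; rewrite /ball /= sub0r normrN (le_lt_trans cz).
Qed.

(** Formally, differentiation of t^k g(t y) under the integral sign gives
    t^(k+1) (t y) g1(t y). *)
Lemma is_derive_average k g g1 y : continuous g -> continuous g1 ->
  (forall z, is_derive z 1 g (z * g1 z)) ->
  is_derive y 1 (average k g) (y * average k.+2 g1 y).
Proof.
move=> cg cg1 dg; have [->|y0] := eqVneq y 0; last first.
  apply: is_derive_eq (is_derive_average_neq0 _ cg y0) _.
  (* Both sides vanish at 0 and have derivative z^(k+2) g1: integration by parts. *)
  have e : y ^+ k.+1 * g y - k.+1%:R * primitive (fun z => z ^+ k * g z) y =
           primitive (fun z => z ^+ k.+2 * g1 z) y.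
    pose F y := y ^+ k.+1 * g y - k.+1%:R * primitive (fun z => z ^+ k * g z) y.
    rewrite -/(F y); congr (_ y).
    apply: (@derive_ext_eq _ _ _ (fun z => z ^+ k.+2 * g1 z)) => [z|z|].
    - apply: is_derive_eq (is_derive_sub (is_derive_mul (is_derive_powX _ _) (dg z))
        (is_derive_cmul _ (is_derive_primitive _ (continuous_powM k cg)))) _.
      by rewrite /= !exprS; ring.
    - exact/is_derive_primitive/continuous_powM.
    - by rewrite /F !primitive0 ?expr0n ?mul0r ?mulr0 ?subr0 //; exact: continuous_powM.
  have {e} : y ^+ k.+1 * (g y - k.+1%:R * average k g y - y * y * average k.+2 g1 y) = 0.
    rewrite -!averageE // in e; move: e; rewrite !(exprS y) => e.
    by move/eqP: e; rewrite -subr_eq0 => /eqP <-; ring.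
  move=> /eqP; rewrite mulf_eq0 expf_eq0 (negbTE y0) andbF /= => /eqP e.
  by rewrite (_ : g y - _ = y * y * average k.+2 g1 y); [field | lra].
rewrite mul0r.
have [C gC] : exists C, forall z, `|z| <= 1 -> `|g1 z| <= C.
  suff [c _ cmax] : exists2 c, c \in `[-1, 1]%R &
      forall z, z \in `[-1, 1]%R -> `|g1 z| <= `|g1 c|.
    by exists `|g1 c| => z z1; apply: cmax; rewrite in_itv /= -ler_norml.
  apply: (@EVT_max R (fun z => `|g1 z|)); first exact: (@le_trans _ _ 0).
  apply: continuous_subspaceT => z; apply: continuous_comp; first exact: cg1.
  exact: norm_continuous.
apply: (@quadratic_is_derive0 _ _ C) => z z1.
have C0 : 0 <= C by apply: le_trans (gC 0 _); rewrite // normr0.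
have [->|z0] := eqVneq z 0; first by rewrite subrr normr0 expr0n mulr0.
have [c cz] := average_mean_value k cg z0; move=> /le_trans; apply.
have [d dc ->] := mean_value0 c dg.
rewrite normrM -(real_normK (num_real z)) normrM expr2 mulrA.
rewrite [C * _]mulrC ler_pM ?mulr_ge0 //; rewrite ler_pM //.
  exact: le_trans cz.
by apply/gC/(le_trans dc)/(le_trans cz).
Qed.

End averages.

(** * Even profiles and the radial Laplacian *)

Section even_smooth.
Context (R : realType).
Implicit Types (f g h : R -> R) (x y z : R) (k n : nat).

(** Up to a factor 2, the quotient of f' by y is the derivative of f with respect
    to y^2, so these are the functions of y^2 of class C^n. It is the regularity of
    a profile f under which f(|x|) has n continuous derivatives, also at the origin. *)
Fixpoint even_diff n f : Prop := even_fun f /\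
  match n with
  | 0 => continuous f
  | n'.+1 => exists g, even_diff n' g /\ forall y, is_derive y 1 f (y * g y)
  end.

Lemma even_diff_even n f : even_diff n f -> even_fun f.
Proof. by case: n => [|n] []. Qed.

Lemma even_diff_continuous n f : even_diff n f -> continuous f.
Proof.
case: n => [|n] [_ //] [g [_ fg]] y; exact: is_derive_continuous (fg y).
Qed.

Lemma even_diffW n f : even_diff n.+1 f -> even_diff n f.
Proof.
elim: n f => [|n IH] f fn; split; try exact: even_diff_even fn.
  exact: even_diff_continuous fn.
by case: fn => _ [g [gn fg]]; exists g; split=> //; exact: IH.
Qed.

Lemma even_diff_leq k n f : (k <= n)%N -> even_diff n f -> even_diff k f.
Proof.
move=> /subnK <-; elim: (n - k)%N => // j IH; rewrite addSn => /even_diffW.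
exact: IH.
Qed.

Lemma even_diff_const n (c : R) : even_diff n (fun=> c).
Proof.
elim: n c => [|n IH] c; split=> //; first exact: cst_continuous.
exists (fun=> 0); split; first exact: IH.
by move=> y; rewrite mulr0; exact: is_derive_const.
Qed.

Lemma even_diff_add n f g : even_diff n f -> even_diff n g ->
  even_diff n (fun y => f y + g y).
Proof.
elim: n f g => [|n IH] f g fn gn.
  split; first by move=> y; rewrite (even_diff_even fn) (even_diff_even gn).
  move=> y; apply: continuousD; first exact: even_diff_continuous fn _.
  exact: even_diff_continuous gn _.
split; first by move=> y; rewrite (even_diff_even fn) (even_diff_even gn).
case: fn gn => _ [f' [f'n ff']] [_ [g' [g'n gg']]].
exists (fun y => f' y + g' y); split; first exact: IH.
by move=> y; apply: is_derive_eq (is_derive_add (ff' y) (gg' y)) _; rewrite mulrDr.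
Qed.

Lemma even_diff_mul n f g : even_diff n f -> even_diff n g ->
  even_diff n (fun y => f y * g y).
Proof.
elim: n f g => [|n IH] f g fn gn.
  split; first by move=> y; rewrite (even_diff_even fn) (even_diff_even gn).
  move=> y; apply: continuousM; first exact: even_diff_continuous fn _.
  exact: even_diff_continuous gn _.
split; first by move=> y; rewrite (even_diff_even fn) (even_diff_even gn).
have [fn' gn'] := (even_diffW fn, even_diffW gn).
case: fn gn => _ [f' [f'n ff']] [_ [g' [g'n gg']]].
exists (fun y => f' y * g y + f y * g' y); split.
  by apply: even_diff_add; exact: IH.
by move=> y; apply: is_derive_eq (is_derive_mul (ff' y) (gg' y)) _; ring.
Qed.

Lemma is_derive_expR_comp f y (df : R) : is_derive y 1 f df ->
  is_derive y 1 (fun z => expR (f z)) (df * expR (f y)).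
Proof.
by move=> df'; rewrite mulrC; exact: is_derive1_comp (is_derive_expR _) df'.
Qed.

Lemma even_diff_expR n f : even_diff n f -> even_diff n (fun y => expR (f y)).
Proof.
elim: n f => [|n IH] f fn; split; try by move=> y; rewrite (even_diff_even fn).
  move=> y; apply: continuous_comp; first exact: even_diff_continuous fn _.
  exact: continuous_expR.
have fn' := even_diffW fn; case: fn => _ [f' [f'n ff']].
exists (fun y => f' y * expR (f y)); split; first by apply: even_diff_mul => //; exact: IH.
by move=> y; apply: is_derive_eq (is_derive_expR_comp (ff' y)) _; rewrite mulrA.
Qed.

Lemma even_diff_average n k g : even_diff n g -> even_diff n (average k g).
Proof.
elim: n k g => [|n IH] k g gn; have cg := even_diff_continuous gn;
  split; try exact: even_average cg (even_diff_even gn).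
  exact: continuous_average.
case: gn => _ [g' [g'n gg']]; exists (average k.+2 g'); split; first exact: IH.
by move=> y; apply: is_derive_average => //; exact: even_diff_continuous g'n.
Qed.

End even_smooth.

Section radial_laplacian_inverse.
Context (R : realType) (N : nat).
Hypothesis N0 : (0 < N)%N.
Implicit Types (f g h p q : R -> R) (x y z r rho : R) (k n : nat).

(** The solution of the radial Poisson equation with right-hand side g that
    vanishes at 0. *)
Definition radial_potential g := primitive (fun z => z * average N.-1 g z).

Lemma continuous_mulX g : continuous g -> continuous (fun z : R => z * g z).
Proof. by move=> cg z; apply: (@continuousM _ _ id g) => //; exact: cg. Qed.

Lemma radial_potential0 g : continuous g -> radial_potential g 0 = 0.
Proof. by move=> cg; exact/primitive0/continuous_mulX/continuous_average. Qed.

Lemma is_derive_radial_potential g y : continuous g ->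
  is_derive y 1 (radial_potential g) (y * average N.-1 g y).
Proof.
move=> cg; have c := continuous_mulX (@continuous_average _ N.-1 _ cg).
exact: is_derive_primitive c.
Qed.

Lemma even_diff_potential n g : even_diff n g -> even_diff n.+1 (radial_potential g).
Proof.
move=> gn; have cg := even_diff_continuous gn.
have ea := even_average N.-1 cg (even_diff_even gn).
split.
  move=> y; rewrite /radial_potential (primitive_parity (s := -1)) ?opprK ?mul1r //.
    exact/continuous_mulX/continuous_average.
  by move=> z; rewrite ea mulNr mulN1r.
exists (average N.-1 g); split; first exact: even_diff_average.
by move=> y; exact: is_derive_radial_potential.
Qed.

(** The equation (r^(N-1) f')' = r^(N-1) p, with f' = r a. The continuity of r^N a at
    0 excludes the singular harmonic function r^(2-N). *)
Definition has_radial_laplacian rho f p :=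
  (forall r, 0 <= r < rho -> {for r, continuous f}) /\
  exists a : R -> R,
  [/\ forall r, 0 < r < rho -> is_derive r 1 f (r * a r),
      forall r, 0 < r < rho ->
        is_derive r 1 (fun r => r ^+ N * a r) (r ^+ N.-1 * p r) &
      {for 0, continuous (fun r => r ^+ N * a r)}].

Lemma radial_laplacian_linear rho f g p q (s t : R) :
  has_radial_laplacian rho f p -> has_radial_laplacian rho g q ->
  has_radial_laplacian rho (fun r => s * f r + t * g r) (fun r => s * p r + t * q r).
Proof.
move=> [cf [a [fa ap a0]]] [cg [b [gb bq b0]]]; split.
  move=> r rrho; apply: continuousD; apply: continuousM; try exact: cst_continuous.
    exact: cf.
  exact: cg.
exists (fun r => s * a r + t * b r).
have E : (fun r => r ^+ N * (s * a r + t * b r)) =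
    (fun r => s * (r ^+ N * a r) + t * (r ^+ N * b r)).
  by apply/funext => r; ring.
rewrite E; split=> [r rr|r rr|].
- apply: is_derive_eq (is_derive_add (is_derive_cmul s (fa r rr))
    (is_derive_cmul t (gb r rr))) _.
  by ring.
- apply: is_derive_eq (is_derive_add (is_derive_cmul s (ap r rr))
    (is_derive_cmul t (bq r rr))) _.
  by ring.
- by apply: continuousD; apply: continuousM => //; exact: cst_continuous.
Qed.

(** Maximum principle: r^N a is nondecreasing and vanishes at 0, so f' = r a >= 0. *)
Lemma radial_laplacian_ge0 rho f p r : has_radial_laplacian rho f p ->
  (forall r, 0 < r < rho -> 0 <= p r) -> 0 <= r < rho -> f 0 <= f r.
Proof.
move=> [cf [a [fa ap a0]]] p0 /andP[r0 rr].
have sub (s : R) : 0 <= s <= r -> s < rho by move=> /andP[_ /le_lt_trans]; apply.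
have aN0 s : 0 < s < r -> 0 <= s ^+ N * a s.
  move=> /andP[s0 sr]; rewrite -[leLHS](_ : 0 ^+ N * a 0 = _); last first.
    by rewrite expr0n eqn0Ngt N0 mul0r.
  apply: (@derive_ge0_le _ (fun s => s ^+ N * a s) (fun s => s ^+ N.-1 * p s)).
  - exact: ltW.
  - move=> t /andP[t0 ts]; apply: ap; rewrite t0 sub // (ltW t0) /=.
    exact/ltW/(lt_trans ts).
  - move=> t /andP[]; rewrite le_eqVlt => /orP[/eqP <- _ //|t0 ts].
    apply: is_derive_continuous (ap t _); rewrite t0 sub // (ltW t0) /=.
    exact/ltW/(le_lt_trans ts).
  - move=> t /andP[t0 ts]; rewrite mulr_ge0 ?exprn_ge0 ?(ltW t0) //.
    by apply: p0; rewrite t0 sub // (ltW t0) /=; exact/ltW/(lt_trans ts).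
apply: (@derive_ge0_le _ f (fun s => s * a s)) => //.
- by move=> s /andP[s0 sr]; apply: fa; rewrite s0 sub // !ltW.
- by move=> s /andP[s0 sr]; apply: cf; rewrite s0 sub // s0.
- move=> s /[dup] /andP[s0 _] /aN0.
  by rewrite pmulr_rge0 ?exprn_gt0 // => as0; rewrite mulr_ge0 ?(ltW s0).
Qed.

Lemma radial_laplacian_le rho f g p q r :
  has_radial_laplacian rho f p -> has_radial_laplacian rho g q ->
  (forall r, 0 < r < rho -> p r <= q r) -> 0 <= r < rho ->
  f r - f 0 <= g r - g 0.
Proof.
move=> fp gq pq rr.
have pos s : 0 < s < rho -> 0 <= -1 * p s + 1 * q s by move=> /pq; lra.
have := radial_laplacian_ge0 (radial_laplacian_linear (-1) 1 fp gq) pos rr; lra.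
Qed.

Lemma radial_laplacian_smooth rho f g h : continuous g ->
  (forall y, is_derive y 1 f (y * g y)) -> (forall y, is_derive y 1 g (y * h y)) ->
  has_radial_laplacian rho f (fun r => N%:R * g r + r ^+ 2 * h r).
Proof.
move=> cg fg gh; split; first by move=> r _; exact: is_derive_continuous (fg r).
have d r : is_derive r 1 (fun r => r ^+ N * g r)
    (r ^+ N.-1 * (N%:R * g r + r ^+ 2 * h r)).
  apply: is_derive_eq (is_derive_mul (is_derive_powX r N) (gh r)) _.
  by case: N N0 => //= n _; rewrite exprS; ring.
exists g; split=> [r _|r _|]; [exact: fg|exact: d|exact: is_derive_continuous (d 0)].
Qed.

Lemma radial_laplacian_potential rho g : continuous g ->
  has_radial_laplacian rho (radial_potential g) g.
Proof.
move=> cg; split.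
  by move=> r _; exact: is_derive_continuous (is_derive_radial_potential r cg).
have d r : is_derive r 1 (fun r => r ^+ N * average N.-1 g r) (r ^+ N.-1 * g r).
  have := is_derive_primitive r (continuous_powM N.-1 cg).
  congr (is_derive _ _ _ _); apply/funext => z.
  by rewrite -averageE // prednK.
exists (average N.-1 g); split=> [r _|r _|].
- exact: is_derive_radial_potential.
- exact: d.
- exact: is_derive_continuous (d 0).
Qed.

(** E = e^(lam r^2) satisfies Delta E = 2 lam (N + 2 lam r^2) E >= 2 lam E, and the
    comparison principle applies. For large lam the inverse Laplacian is thus a
    contraction in the norm weighted by E, on any interval. *)
Lemma gaussian_weight_bound rho f p (lam D : R) r : 0 < lam -> 0 <= D ->
  has_radial_laplacian rho f p -> f 0 = 0 ->
  (forall r, 0 < r < rho -> `|p r| <= D * expR (lam * r ^+ 2)) ->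
  0 <= r < rho -> `|f r| <= D / (2 * lam) * expR (lam * r ^+ 2).
Proof.
move=> lam0 D0 fp f0 pD rr.
pose E y := expR (lam * y ^+ 2).
have dE y : is_derive y 1 E (y * (2 * lam * E y)).
  apply: is_derive_eq (is_derive_expR_comp (is_derive_cmul lam (is_derive_powX y 2))) _.
  by rewrite /E /= expr1; ring.
have dE2 y : is_derive y 1 (fun y => 2 * lam * E y) (y * ((2 * lam) ^+ 2 * E y)).
  by apply: is_derive_eq (is_derive_cmul _ (dE y)) _; ring.
have cE y : {for y, continuous (fun y => 2 * lam * E y)}.
  exact: is_derive_continuous (dE2 y).
have EL := radial_laplacian_smooth rho cE dE dE2.
have zero : has_radial_laplacian rho (fun=> 0 : R) (fun=> 0).
  have c0 : continuous (fun _ : R => 0 : R) by exact: cst_continuous.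
  have := radial_laplacian_smooth rho c0 (f := fun=> 0) (h := fun=> 0).
  have d0 (y : R) : is_derive y 1 (fun=> 0 : R) (y * 0).
    by rewrite mulr0; exact: is_derive_const.
  move=> /(_ d0 d0); congr has_radial_laplacian.
  by apply/funext => y; rewrite !mulr0 addr0.
have key (s : R) : `|s| = 1 -> s * f r <= D / (2 * lam) * E r.
  move=> s1.
  have pq t : 0 < t < rho -> s * p t + 0 * 0 <= D / (2 * lam) *
      (N%:R * (2 * lam * E t) + t ^+ 2 * ((2 * lam) ^+ 2 * E t)) + 0 * 0.
    move=> tr; rewrite !mulr0 !addr0; apply: (le_trans (ler_norm _)).
    rewrite normrM s1 mul1r; apply: (le_trans (pD t tr)).
    have -> : D / (2 * lam) * (N%:R * (2 * lam * E t) + t ^+ 2 * ((2 * lam) ^+ 2 * E t)) =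
       D * E t * (N%:R + t ^+ 2 * (2 * lam)).
      by field; rewrite gt_eqF.
    rewrite -/(E t) ler_peMr ?mulr_ge0 ?expR_ge0 // ler_wpDr ?ler1n //.
    by rewrite mulr_ge0 ?sqr_ge0 // mulr_ge0 // ltW.
  have := radial_laplacian_le (radial_laplacian_linear s 0 fp zero)
    (radial_laplacian_linear (D / (2 * lam)) 0 EL zero) pq rr.
  rewrite f0 !mulr0 !addr0 subr0 => /le_trans; apply.
  rewrite gerBl // mulr_ge0 ?expR_ge0 // divr_ge0 //.
  by rewrite mulr_ge0 // ltW.
rewrite ler_norml -/(E r); apply/andP; split.
  by have := key (-1); rewrite normrN1 => /(_ erefl); lra.
by have := key 1; rewrite normr1 => /(_ erefl); lra.
Qed.

End radial_laplacian_inverse.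

(** * Iterated radial potentials and the truncated fixed point *)

Section towers.
Context (R : realType) (N : nat).
Hypothesis N0 : (0 < N)%N.
Implicit Types (f g h v w : R -> R) (x y z r rho a b t : R) (k n : nat) (l : seq R).

(** The entries of l are the values at 0 of the successive Laplacians, and v is the
    Laplacian of order size l. *)
Fixpoint tower l v : R -> R :=
  if l is a :: l' then fun y => a + radial_potential N (tower l' v) y else v.

Lemma tower_rcons l b v :
  tower (rcons l b) v = tower l (fun y => b + radial_potential N v y).
Proof. by elim: l => //= a l ->. Qed.

Lemma even_diff_tower n l v : even_diff n v -> even_diff (n + size l) (tower l v).
Proof.
move=> vn; elim: l => [|a l IH] /=; first by rewrite addn0.
rewrite addnS; apply: even_diff_add; first exact: even_diff_const.
exact: even_diff_potential.
Qed.

Lemma continuous_tower l v : continuous v -> continuous (tower l v).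
Proof.
move=> cv; elim: l => //= a l IH y; apply: continuousD; first exact: cst_continuous.
exact: is_derive_continuous (is_derive_radial_potential N y IH).
Qed.

Lemma tower0 a l v : continuous v -> tower (a :: l) v 0 = a.
Proof. by move=> cv; rewrite /= radial_potential0 ?addr0 //; exact: continuous_tower. Qed.

Lemma radial_potential_le g h r : continuous g -> continuous h ->
  (forall r, 0 <= r -> g r <= h r) -> 0 <= r ->
  radial_potential N g r <= radial_potential N h r.
Proof.
move=> cg ch gh r0.
have := radial_laplacian_le N0 (radial_laplacian_potential N0 (r + 1) cg)
  (radial_laplacian_potential N0 (r + 1) ch) _ (r := r).
rewrite !radial_potential0 // !subr0; apply; last by rewrite r0 ltrDl ltr01.
by move=> s /andP[s0 _]; exact/gh/ltW.
Qed.

Lemma tower_le l g h : continuous g -> continuous h ->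
  (forall r, 0 <= r -> g r <= h r) ->
  forall r, 0 <= r -> tower l g r <= tower l h r.
Proof.
move=> cg ch gh; elim: l => //= a l IH r r0; rewrite lerD2l.
by apply: radial_potential_le => //; exact: continuous_tower.
Qed.

Lemma tower_contract l g h (lam D : R) : 0 < lam -> 0 <= D ->
  continuous g -> continuous h ->
  (forall r, 0 <= r -> `|g r - h r| <= D * expR (lam * r ^+ 2)) ->
  forall r, 0 <= r ->
  `|tower l g r - tower l h r| <= D / (2 * lam) ^+ size l * expR (lam * r ^+ 2).
Proof.
move=> lam0 D0 cg ch gh; elim: l => /= [|a l IH] r r0.
  by rewrite expr0 divr1; exact: gh.
rewrite opprD addrACA subrr add0r exprSr invfM mulrA.
have ct v : continuous v -> continuous (tower l v) by exact: continuous_tower.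
have pot v cv := radial_laplacian_potential N0 (r + 1) (ct v cv).
have := @gaussian_weight_bound R N N0 _ _ _ lam _ r lam0 _
  (radial_laplacian_linear 1 (-1) (pot g cg) (pot h ch)).
rewrite !mul1r !mulN1r; apply.
- by rewrite divr_ge0 // exprn_ge0 // mulr_ge0 // ltW.
- by rewrite !radial_potential0 ?subr0 //; exact: ct.
- by move=> s /andP[s0 _]; rewrite mul1r mulN1r; apply/IH/ltW.
- by rewrite r0 ltrDl ltr01.
Qed.

Lemma radial_laplacian_power rho k :
  has_radial_laplacian N rho (fun r : R => r ^+ (2 * k.+1))
    (fun r => (2 * k.+1)%:R * (N + 2 * k)%:R * r ^+ (2 * k)).
Proof.
have dp j y : is_derive y 1 (fun y : R => y ^+ (2 * j)) (y * ((2 * j)%:R * y ^+ (2 * j.-1))).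
  apply: is_derive_eq (is_derive_powX _ _) _; case: j => [|j]; first by rewrite muln0 !mul0r mulr0.
  by rewrite [(2 * j.+1)%N]mulnS /= exprS; ring.
have c : continuous (fun y : R => (2 * k.+1)%:R * y ^+ (2 * k)).
  move=> y; exact: is_derive_continuous (is_derive_cmul _ (is_derive_powX y _)).
have d2 y : is_derive y 1 (fun y : R => (2 * k.+1)%:R * y ^+ (2 * k))
    (y * ((2 * k.+1)%:R * ((2 * k)%:R * y ^+ (2 * k.-1)))).
  by apply: is_derive_eq (is_derive_cmul _ (dp k y)) _; ring.
have := radial_laplacian_smooth N0 rho c (dp k.+1) d2.
congr has_radial_laplacian; apply/funext => r; rewrite natrD mulrDr mulrDl.
congr (_ + _); first by ring.
case: k {dp c d2} => [|k]; first by rewrite muln0; ring.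
by rewrite [(2 * k.+1)%N]mulnS /= !exprS; ring.
Qed.

Lemma radial_laplacian_const rho (c : R) :
  has_radial_laplacian N rho (fun=> c) (fun=> 0).
Proof.
have c0 : continuous (fun _ : R => 0 : R) by exact: cst_continuous.
have d (e y : R) : is_derive y 1 (fun=> e) (y * 0 : R).
  by rewrite mulr0; exact: is_derive_const.
have := radial_laplacian_smooth N0 rho c0 (d c) (d 0).
by congr has_radial_laplacian; apply/funext => y; rewrite !mulr0 addr0.
Qed.

(** For constant v = t the tower is a polynomial in r^2 whose leading coefficient is
    a positive multiple of t; the lower powers are absorbed by
    r^2 <= 1 + r^(2k+2). *)
Lemma tower_const_le l : exists C D kappa : R, [/\ 0 <= C, 0 < kappa &
  forall t r, 0 <= r ->
    tower l (fun=> t) r <= C + (D + kappa * t) * r ^+ (2 * size l)].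
Proof.
elim: l => [|a l [C [D [kappa [C0 kappa0 IH]]]]].
  exists 0, 0, 1; split=> // t r _.
  by rewrite muln0 expr0 mulr1 mul1r !add0r.
pose q : R := (2 * (size l).+1)%:R * (N + 2 * size l)%:R.
have q0 : 0 < q by rewrite mulr_gt0 // ltr0n ?addn_gt0 ?N0.
exists (`|a| + C), (C + D / q), (kappa / q); split; first by rewrite addr_ge0.
  by rewrite divr_gt0.
move=> t r r0 /=.
have cT : continuous (tower l (fun=> t)).
  by apply: continuous_tower; exact: cst_continuous.
pose rho := r + 1.
have up : has_radial_laplacian N rho
    (fun r => C / (2 * N)%:R * r ^+ 2 + (D + kappa * t) / q * r ^+ (2 * (size l).+1))
    (fun r => C + (D + kappa * t) * r ^+ (2 * size l)).
  have := radial_laplacian_linear (C / (2 * N)%:R) ((D + kappa * t) / q)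
    (radial_laplacian_power rho 0) (radial_laplacian_power rho (size l)).
  congr has_radial_laplacian; apply/funext => s.
  rewrite -/q [(D + _) / q * _](_ : _ = (D + kappa * t) * s ^+ (2 * size l)).
    rewrite !muln0 muln1 addn0 expr0 mulr1 -natrM divfK //.
    by rewrite pnatr_eq0 muln_eq0 -lt0n N0.
  by field; rewrite gt_eqF.
have le s : 0 < s < rho -> tower l (fun=> t) s <= C + (D + kappa * t) * s ^+ (2 * size l).
  by move=> /andP[/ltW s0 _]; exact: IH.
have rr : 0 <= r < rho by rewrite r0 ltrDl ltr01.
have := radial_laplacian_le N0 (radial_laplacian_potential N0 rho cT) up le rr.
rewrite radial_potential0 // subr0 !expr0n /= !mulr0 addr0 subr0 => pot.
have r2 : r ^+ 2 <= 1 + r ^+ (2 * (size l).+1).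
  have [r1|r1] := leP r 1.
    by rewrite (le_trans (exprn_ile1 _ r0 r1)) // lerDl exprn_ge0.
  by rewrite (le_trans (ler_weXn2l (ltW r1) (_ : 2 <= 2 * (size l).+1)%N)) ?lerDr // leq_pmulr.
have Cr : C / (2 * N)%:R * r ^+ 2 <= C * (1 + r ^+ (2 * (size l).+1)).
  rewrite ler_pM ?sqr_ge0 ?divr_ge0 // ler_pdivrMr ?ler_peMr ?ltr0n ?muln_gt0 //.
  by rewrite ler1n muln_gt0.
have := ler_norm a; move: (r ^+ (2 * _)) Cr pot => X Cr pot an.
have -> : (C + D / q + kappa / q * t) * X = C * X + (D + kappa * t) / q * X.
  by field; rewrite gt_eqF.
lra.
Qed.

End towers.

Section fixed_point.
Context (R : realType) (N : nat).
Hypothesis N0 : (0 < N)%N.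
Implicit Types (f g h v w : R -> R) (x y z r rho a b t : R) (k n : nat) (l : seq R).

(** The intervals with center u n and radius 2 D / 2^n are nested. *)
Lemma geometric_cauchy_limit (u : nat -> R) (D : R) : 0 <= D ->
  (forall n, `|u n.+1 - u n| <= D / 2 ^+ n) ->
  exists x, forall n, `|x - u n| <= 2 * D / 2 ^+ n.
Proof.
move=> D0 uD; pose c n : R := 2 * D / 2 ^+ n.
have cS n : c n = 2 * c n.+1 by rewrite /c exprS; field; rewrite expf_neq0.
have Dc n : D / 2 ^+ n = c n.+1 by rewrite /c exprS; field; rewrite expf_neq0.
have c0 n : 0 <= c n by rewrite /c divr_ge0 ?mulr_ge0 ?exprn_ge0.
have lo n k : u n - c n <= u (n + k)%N - c (n + k)%N.
  elim: k => [|k]; rewrite ?addn0 // addnS => /le_trans; apply.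
  have := uD (n + k)%N; rewrite Dc ler_norml (cS (n + k)%N) => /andP[]; lra.
have hi n k : u (n + k)%N + c (n + k)%N <= u n + c n.
  elim: k => [|k]; rewrite ?addn0 // addnS; apply: le_trans.
  have := uD (n + k)%N; rewrite Dc ler_norml (cS (n + k)%N) => /andP[]; lra.
have lh n p : u n - c n <= u p + c p.
  have := lo n p; have := hi p n; rewrite addnC; have := c0 (n + p)%N; lra.
pose A := [set u n - c n | n in [set: nat]].
have A0 : A !=set0 by exists (u 0%N - c 0%N); exists 0%N.
exists (sup A) => n; rewrite ler_distl; apply/andP; split.
  apply: ub_le_sup; last by exists n.
  by exists (u 0%N + c 0%N) => _ [k _ <-].
by apply: ge_sup => // _ [k _ <-].
Qed.

Lemma geometric_small (D e : R) : 0 <= D -> 0 < e -> exists n, D / 2 ^+ n <= e.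
Proof.
move=> D0 e0; exists (Num.trunc (D / e)).+1.
rewrite ler_pdivrMr ?exprn_gt0 // mulrC -ler_pdivrMr //.
apply: (le_trans (ltW (truncnS_gt _))); rewrite -natrX ler_nat.
exact/ltnW/ltn_expl.
Qed.

Lemma continuous_gaussian_limit (wn : nat -> R -> R) w (lam D : R) :
  0 <= lam -> 0 <= D -> (forall n, continuous (wn n)) ->
  (forall n y, `|w y - wn n y| <= D / 2 ^+ n * expR (lam * y ^+ 2)) -> continuous w.
Proof.
move=> lam0 D0 cwn wwn y; apply/cvgrPdist_le => e e0.
pose E := expR (lam * (`|y| + 1) ^+ 2).
have Eb z : `|z| <= `|y| + 1 -> expR (lam * z ^+ 2) <= E.
  move=> zy; rewrite ler_expR ler_wpM2l // -(real_normK (num_real z)).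
  by rewrite ler_pXn2r // nnegrE ?addr_ge0.
have [n Dn] := @geometric_small (D * E) (e / 3) (mulr_ge0 D0 (expR_ge0 _)) ltac:(lra).
have DnE z : `|z| <= `|y| + 1 -> `|w z - wn n z| <= e / 3.
  move=> zy; apply: (le_trans (wwn n z)); apply: le_trans Dn.
  by rewrite mulrAC ler_wpM2r ?invr_ge0 ?exprn_ge0 // ler_wpM2l // Eb.
have /cvgrPdist_le /(_ (e / 3) ltac:(lra)) near_n := cwn n y.
near=> z.
have zy : `|z| <= `|y| + 1.
  have : `|y - z| <= 1 by near: z; apply: cvgr_dist_le => //; exact: ltr01.
  have := ler_normD (z - y) y; rewrite subrK distrC; lra.
have h1 : `|wn n y - wn n z| <= e / 3 by near: z.
have h2 := DnE z zy; have h3 : `|w y - wn n y| <= e / 3 by apply: DnE; rewrite lerDl.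
move: h1 h2 h3; rewrite !ler_norml => /andP[? ?] /andP[? ?] /andP[? ?].
apply/andP; split; lra.
Unshelve. all: by end_near. Qed.

Lemma expR_min_lipschitz (c C x y : R) : c <= C ->
  `|expR (Num.min x c) - expR (Num.min y c)| <= expR C * `|x - y|.
Proof.
move=> cC; wlog xy : x y / y <= x.
  move=> H; have [|/ltW] := leP y x; first exact: H.
  by rewrite distrC (distrC x); exact: H.
have mxy : Num.min y c <= Num.min x c by rewrite le_min !ge_min xy lexx orbT.
rewrite !ger0_norm ?subr_ge0 ?ler_expR //.
have le : Num.min x c - Num.min y c <= x - y.
  rewrite /Num.min; do 2 case: ifP; lra.
have mC : expR (Num.min x c) <= expR C by rewrite ler_expR ge_min cC orbT.
move: (Num.min x c) (Num.min y c) mxy le mC => p q qp pq pC.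
have h : expR p * (1 + (q - p)) <= expR q.
  rewrite -[leRHS](_ : expR (p + (q - p)) = _); last by congr expR; lra.
  by rewrite expRD ler_wpM2l ?expR_ge0 // expR_ge1Dx.
have : expR p - expR q <= expR p * (p - q) by lra.
by move=> /le_trans; apply; rewrite ler_pM ?expR_ge0 ?subr_ge0.
Qed.

(** Picard iteration in the norm weighted by e^(lam r^2). Truncating at W <= C makes
    the exponential Lipschitz with constant e^C; evaluating at |y| makes the
    nonlinearity even, so that only r >= 0 has to be controlled. *)
Lemma truncated_fixed_point l (W : R -> R) (C s : R) : `|s| = 1 -> (0 < size l)%N ->
  continuous W -> (forall r, 0 <= r -> W r <= C) ->
  exists F, continuous F /\
    F = tower N l (fun y => s * expR (Num.min (F `|y|) (W `|y|))).
Proof.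
move=> s1 l0 cW WC.
pose G w y := s * expR (Num.min (w `|y|) (W `|y|)).
have cabs w : continuous w -> continuous (fun y : R => w `|y|).
  move=> cw y; apply: (@continuous_comp R R R (fun y => `|y|) w y); last exact: cw.
  exact: norm_continuous.
have cG w : continuous w -> continuous (G w).
  move=> cw y; apply: (@continuousM _ _ (fun=> s) (fun y => expR (Num.min (w `|y|) (W `|y|)))); first exact: cst_continuous.
  apply: (@continuous_comp R R R (fun y => Num.min (w `|y|) (W `|y|)) expR y).
    by apply: continuous_min; exact: cabs.
  exact: continuous_expR.
pose M := expR C; have M0 : 0 < M := expR_gt0 _.
(* One potential shrinks the weighted norm by 1/(2 lam), which offsets the
   Lipschitz constant M and leaves a factor 1/2. *)
pose lam := M + 1; have lam0 : 0 < lam by rewrite /lam; lra.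
have lamM : M / (2 * lam) ^+ size l <= 2^-1.
  rewrite ler_pdivrMr ?exprn_gt0 ?mulr_gt0 // mulrC ler_pdivlMr //.
  apply: (@le_trans _ _ (2 * lam)); first by rewrite /lam; lra.
  by rewrite ler_eXnr // /lam; lra.
have contr (D : R) w w' : 0 <= D -> continuous w -> continuous w' ->
    (forall r, 0 <= r -> `|w r - w' r| <= D * expR (lam * r ^+ 2)) ->
    forall r, 0 <= r -> `|tower N l (G w) r - tower N l (G w') r| <=
      D / 2 * expR (lam * r ^+ 2).
  move=> D0 cw cw' ww' r r0.
  have := @tower_contract R N N0 l (G w) (G w') lam (D * M) lam0
    (mulr_ge0 D0 (ltW M0)) (cG w cw) (cG w' cw') _ r r0.
  move=> H; apply: le_trans (H _) _ => [q q0|]; last first.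
    by rewrite ler_wpM2r ?expR_ge0 // -mulrA ler_wpM2l.
  rewrite /G -mulrBr normrM s1 mul1r (ger0_norm q0) (mulrC D) -mulrA.
  by apply: le_trans (expR_min_lipschitz _ _ (WC q q0)) _; rewrite ler_wpM2l ?ww' // ltW.
pose w0 := tower N l (fun=> 0).
pose wn := fix wn n := if n is n'.+1 then tower N l (G (wn n')) else w0.
have cwn n : continuous (wn n).
  case: n => [|n]; first by apply: continuous_tower => //; exact: cst_continuous.
  elim: n => [|n IH]; apply: continuous_tower => //; apply: cG => //.
  by apply: continuous_tower => //; exact: cst_continuous.
have wnS n r : 0 <= r -> `|wn n.+1 r - wn n r| <= 2^-1 / 2 ^+ n * expR (lam * r ^+ 2).
  elim: n r => [|n IH] r r0; last first.
    rewrite exprSr invfM mulrA.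
    exact: (contr _ (wn n.+1) (wn n) _ (cwn n.+1) (cwn n) IH).
  rewrite expr0 divr1; have c0 : continuous (fun _ : R => 0 : R) by exact: cst_continuous.
  have := @tower_contract R N N0 l (G w0) (fun=> 0) lam M lam0 (ltW M0)
    (cG w0 (cwn 0%N)) c0 _ r r0.
  move=> H; apply: le_trans (H _) _ => [q q0|]; last by rewrite ler_wpM2r ?expR_ge0.
  rewrite subr0 /G normrM s1 mul1r (ger0_norm (expR_ge0 _)).
  apply: (@le_trans _ _ M); first by rewrite ler_expR ge_min (ger0_norm q0) WC ?orbT.
  rewrite ler_peMr ?(ltW M0) // -expR0 ler_expR.
  by rewrite mulr_ge0 ?sqr_ge0 // ltW.
have lim y : exists x, forall n,
    `|x - wn n `|y| | <= expR (lam * y ^+ 2) / 2 ^+ n.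
  have [|n|x xP] := @geometric_cauchy_limit (fun n => wn n `|y|) (2^-1 * expR (lam * y ^+ 2)).
  - by rewrite mulr_ge0 ?expR_ge0.
  - by rewrite mulrAC -(real_normK (num_real y)); exact: wnS.
  - by exists x => n; have := xP n; rewrite mulrA divff // mul1r.
pose w y := projT1 (cid (lim y)).
have wP n y : `|w y - wn n `|y| | <= 1 / 2 ^+ n * expR (lam * y ^+ 2).
  by rewrite mul1r mulrC; exact: (projT2 (cid (lim y))).
have cw : continuous w.
  apply: (@continuous_gaussian_limit (fun n y => wn n `|y|) w lam 1) => //.
    exact: ltW.
  by move=> n; exact: cabs.
have fix_w r : 0 <= r -> tower N l (G w) r = w r.
  move=> r0; apply/eqP; rewrite -subr_eq0 -normr_le0; apply/ler_addgt0Pr => e e0.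
  rewrite add0r.
  have [n en] := geometric_small (mulr_ge0 (ler0n R 2) (expR_ge0 (lam * r ^+ 2))) e0.
  apply: le_trans en.
  have h1 := wP n.+1 r; rewrite (ger0_norm r0) in h1.
  have h2 : `|tower N l (G w) r - wn n.+1 r| <= 1 / 2 ^+ n / 2 * expR (lam * r ^+ 2).
    have wq q : 0 <= q -> `|w q - wn n q| <= 1 / 2 ^+ n * expR (lam * q ^+ 2).
      by move=> q0; have := wP n q; rewrite (ger0_norm q0).
    exact: (contr _ w (wn n) _ cw (cwn n) wq).
  rewrite -(subrK (wn n.+1 r) (tower N l (G w) r)) -addrA.
  apply: (le_trans (ler_normD _ _)); rewrite (distrC (wn n.+1 r)).
  apply: (le_trans (lerD h2 h1)); rewrite (exprS 2 n).
  have : 0 < 2 ^+ n :> R by exact: exprn_gt0.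
  move: (2 ^+ n) (expR _) (expR_ge0 (lam * r ^+ 2)) => X E E0 X0.
  have -> : 1 / X / 2 * E + 1 / (2 * X) * E = E / X by field; rewrite gt_eqF.
  by rewrite ler_wpM2r ?invr_ge0 ?(ltW X0) // mulrC; lra.
exists (tower N l (G w)); split; first by apply: continuous_tower => //; exact: cG.
congr (tower _ _); apply/funext => y; rewrite /G fix_w //.
Qed.

End fixed_point.

(** * The global profile and its decay *)

Section global_profile.
Context (R : realType) (N : nat).
Implicit Types (f g h v w : R -> R) (x y z r rho a b t eps : R) (k n m : nat) (l : seq R).

(** For s <= eps, the choice of eps gives (2 eps)^m <= e^(- C). For s > eps,
    (2 s)^m <= e^(2 m s), and L s^p >= L eps^(p-1) s exceeds 2 m s + C. *)
Lemma exp_decay_le_power m p (C : R) : 0 <= C -> (0 < m)%N -> (0 < p)%N ->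
  exists eps L0 : R, [/\ 0 < eps, 0 <= L0 & forall L s, L0 <= L -> 0 <= s ->
    expR (C - L * s ^+ p) <= (eps + s)^-1 ^+ m].
Proof.
move=> C0 m0 p0; pose eps := expR (- C) / 2.
have eps0 : 0 < eps by rewrite divr_gt0 ?expR_gt0.
pose L0 := (2 * m%:R + C / eps) / eps ^+ p.-1.
have L00 : 0 <= L0.
  apply: divr_ge0; last exact/exprn_ge0/ltW.
  by apply: addr_ge0; [exact: mulr_ge0 | exact: divr_ge0 C0 (ltW eps0)].
exists eps, L0; split=> // L s LL s0.
have es0 : 0 < eps + s by rewrite ltr_wpDr.
rewrite exprVn -[leRHS]div1r ler_pdivlMr ?exprn_gt0 //.
have [se|es] := leP s eps.
  apply: (@le_trans _ _ (expR C * expR (- C))); last by rewrite -expRD subrr expR0.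
  rewrite ler_pM ?expR_ge0 ?exprn_ge0 ?(ltW es0) //.
    by rewrite ler_expR gerBl mulr_ge0 ?exprn_ge0 // (le_trans L00).
  apply: (@le_trans _ _ (expR (- C) ^+ m)).
    have h : eps + s <= expR (- C) by move: se; rewrite /eps; lra.
    by rewrite lerXn2r ?nnegrE ?expR_ge0 ?(ltW es0).
  by rewrite -{2}(expr1 (expR (- C))) ler_wiXn2l ?expR_ge0 // -expR0 ler_expR oppr_le0.
apply: (@le_trans _ _ (expR (C - L * s ^+ p) * expR (m%:R * (2 * s)))).
  rewrite ler_wpM2l ?expR_ge0 // expRM_natl lerXn2r ?nnegrE ?expR_ge0 ?(ltW es0) //.
  by apply: le_trans (expR_ge1Dx _); lra.
rewrite -expRD expR_le1.
have Ls : (2 * m%:R + C / eps) * s <= L * s ^+ p.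
  rewrite -[in leRHS](prednK p0) exprSr mulrA ler_wpM2r //.
  apply: (@le_trans _ _ (L0 * eps ^+ p.-1)); first by rewrite divfK ?expf_neq0 ?gt_eqF.
  rewrite ler_pM ?exprn_ge0 ?(ltW eps0) // lerXn2r ?nnegrE ?(ltW eps0) //.
  exact: ltW.
have Cs : C <= C / eps * s.
  by rewrite -mulrA ler_peMr // mulrC ler_pdivlMr // mul1r ltW.
lra.
Qed.

Lemma inverse_quadratic_derive eps y : 0 < eps ->
  is_derive y 1 (fun y => (eps + y ^+ 2)^-1) (y * (- 2 * ((eps + y ^+ 2)^-1) ^+ 2)).
Proof.
move=> eps0; have e0 : eps + y ^+ 2 != 0 by rewrite gt_eqF // ltr_wpDr ?sqr_ge0.
have d : is_derive y 1 (fun y => eps + y ^+ 2) (0 + 2%:R * y ^+ 1).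
  exact: is_derive_add (is_derive_const _ _ _) (is_derive_powX y 2).
apply: is_derive_eq (@is_derive_inv _ _ (fun y => eps + y ^+ 2) y 1 _ e0 d) _.
by rewrite /= expr1; field.
Qed.

(** With Q = (eps + r^2)^(-1), - Delta Q = Q^2 (2 N - 8 r^2 Q) >= 2 Q^2 because
    N >= 5; so the potential of Q^m <= eps^(2-m) Q^2 is at most
    eps^(2-m) (Q 0 - Q r) / 2. *)
Lemma radial_potential_power_bound g eps m : (5 <= N)%N -> (2 <= m)%N -> 0 < eps ->
  continuous g -> (forall r, 0 <= r -> g r <= (eps + r ^+ 2)^-1 ^+ m) ->
  forall r, 0 <= r -> radial_potential N g r <= eps^-1 ^+ m.-1 / 2.
Proof.
move=> N5 m2 eps0 cg gm r r0.
have N0 : (0 < N)%N by apply: leq_trans N5.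
pose Q y := (eps + y ^+ 2)^-1.
have dQ y : is_derive y 1 Q (y * (- 2 * Q y ^+ 2)) by exact: inverse_quadratic_derive.
have dQ2 y : is_derive y 1 (fun y => - 2 * Q y ^+ 2) (y * (8 * Q y ^+ 3)).
  by apply: is_derive_eq (is_derive_cmul _ (is_derive_exprn 2 (dQ y))) _; rewrite /= expr1; ring.
have cQ : continuous (fun y => - 2 * Q y ^+ 2).
  by move=> y; exact: is_derive_continuous (dQ2 y).
pose e := eps^-1 ^+ m.-2.
have e0 : 0 <= e by rewrite exprn_ge0 // invr_ge0 ltW.
have rr : 0 <= r < r + 1 by rewrite r0 ltrDl ltr01.
have Q0 y : 0 < Q y by rewrite invr_gt0 ltr_wpDr ?sqr_ge0.
have Qe y : Q y <= eps^-1.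
  by rewrite lef_pV2 ?posrE ?lerDl ?sqr_ge0 // ltr_wpDr ?sqr_ge0.
have Qy y : y ^+ 2 * Q y <= 1.
  by rewrite ler_pdivrMr ?mul1r ?lerDr ?(ltW eps0) // ltr_wpDr ?sqr_ge0.
have QL := radial_laplacian_smooth N0 (r + 1) cQ dQ dQ2.
have := radial_laplacian_le N0 (radial_laplacian_potential N0 (r + 1) cg)
  (radial_laplacian_linear (- (e / 2)) 0 QL (radial_laplacian_const N0 (r + 1) 0)) _ rr.
rewrite radial_potential0 // subr0 !mulr0 !addr0.
move=> H; apply: le_trans (H _) _ => [s /andP[s0 _]|].
  rewrite /= ?mulr0 ?addr0; apply: le_trans (gm s (ltW s0)) _; rewrite -/(Q s).
  have -> : Q s ^+ m = Q s ^+ m.-2 * Q s ^+ 2 by case: m m2 {gm e e0 H} => [|[|m]] //= _; rewrite -exprD addn2.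
  apply: (@le_trans _ _ (e * Q s ^+ 2)).
    by rewrite ler_wpM2r ?sqr_ge0 // lerXn2r ?nnegrE ?(ltW (Q0 _)) // invr_ge0 ltW.
  have -> : - (e / 2) * (N%:R * (- 2 * Q s ^+ 2) + s ^+ 2 * (8 * Q s ^+ 3)) =
     e * Q s ^+ 2 * (N%:R - 4 * (s ^+ 2 * Q s)) by field.
  rewrite ler_peMr //; first exact: mulr_ge0 e0 (sqr_ge0 _).
  have : 5 <= N%:R :> R by rewrite ler_nat.
  have := Qy s; lra.
have Qzero : Q 0 = eps^-1 by rewrite /Q expr0n addr0.
have -> : eps^-1 ^+ m.-1 / 2 = e / 2 * Q 0.
  by rewrite Qzero /e; case: m m2 {gm e e0 H} => [|[|m]] //= _; rewrite exprSr; ring.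
have := mulr_ge0 e0 (ltW (Q0 r)); lra.
Qed.

(** W, the tower of l over the constant b + K, dominates the fixed point of the
    problem truncated at W, since the innermost potential is at most K. So the
    truncation is inactive. *)
Theorem global_profile m l (s : R) : `|s| = 1 -> (2 <= m)%N -> (2 * m < N)%N ->
  size l = m.-1 ->
  exists eps beta : R, 0 < eps /\ forall b, b <= beta ->
    exists F, [/\ forall n, even_diff n F,
      F = tower N (rcons l b) (fun y => s * expR (F y)) &
      forall r, 0 <= r -> expR (F r) <= (eps + r ^+ 2)^-1 ^+ m].
Proof.
move=> s1 m2 mN sl.
have N5 : (5 <= N)%N by apply: leq_trans mN; rewrite ltnS (leq_mul2l 2 2).
have N0 : (0 < N)%N by apply: leq_trans N5.
have m0 : (0 < m)%N by apply: leq_trans m2.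
have [C [D [kappa [C0 kappa0 Wle]]]] := tower_const_le N0 l.
have p0 : (0 < size l)%N by rewrite sl -subn1 subn_gt0.
have [eps [L0 [eps0 L00 decay]]] := exp_decay_le_power C0 m0 p0.
pose K := eps^-1 ^+ m.-1 / 2.
(* K bounds the potential of (eps + r^2)^(-m), hence that of e^W once W is known
   to decay; beta makes the leading coefficient D + kappa (b + K) of W at most - L0. *)
exists eps, ((- L0 - D) / kappa - K); split=> // b bbeta.
pose W := tower N l (fun=> b + K).
have cW : continuous W by apply: continuous_tower => //; exact: cst_continuous.
have kb : D + kappa * (b + K) <= - L0.
  by move: bbeta; rewrite lerBrDr ler_pdivlMr // mulrC; lra.
have WL r : 0 <= r -> W r <= C - L0 * (r ^+ 2) ^+ size l.
  move=> r0; apply: (le_trans (Wle _ _ r0)); rewrite lerD2l -exprM -mulNr.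
  by rewrite ler_wpM2r // exprn_ge0.
have WC r : 0 <= r -> W r <= C.
  move=> /WL /le_trans; apply; rewrite gerBl mulr_ge0 // exprn_ge0 //.
  exact: sqr_ge0.
have Wdecay r : 0 <= r -> expR (W r) <= (eps + r ^+ 2)^-1 ^+ m.
  move=> r0; apply: le_trans (decay L0 _ (lexx _) (sqr_ge0 r)).
  by rewrite ler_expR WL.
have [|F [cF EF]] := @truncated_fixed_point R N N0 (rcons l b) W C s s1 _ cW WC.
  by rewrite size_rcons.
pose g y := s * expR (Num.min (F `|y|) (W `|y|)).
have cg : continuous g.
  have cabs w : continuous w -> continuous (fun y : R => w `|y|).
    move=> cw y; apply: (@continuous_comp R R R (fun y => `|y|) w y); last exact: cw.
    exact: norm_continuous.
  move=> y; apply: (@continuousM _ _ (fun=> s) (fun y => expR (Num.min (F `|y|) (W `|y|)))).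
    exact: cst_continuous.
  apply: (@continuous_comp R R R (fun y => Num.min (F `|y|) (W `|y|)) expR y).
    by apply: continuous_min; exact: cabs.
  exact: continuous_expR.
have gpow r : 0 <= r -> g r <= (eps + r ^+ 2)^-1 ^+ m.
  move=> r0; apply: le_trans (Wdecay r r0).
  rewrite (le_trans (ler_norm _)) // normrM s1 mul1r (ger0_norm (expR_ge0 _)).
  by rewrite ler_expR ge_min (ger0_norm r0) lexx orbT.
have FW r : 0 <= r -> F r <= W r.
  rewrite EF tower_rcons -/g => r0.
  have cp : continuous (fun y => b + radial_potential N g y).
    exact: (@continuous_tower R N [:: b] g).
  apply: tower_le => // [|q q0]; first exact: cst_continuous.
  by rewrite lerD2l; exact: radial_potential_power_bound cg gpow q q0.
have ge y : g y = s * expR (F `|y|) by rewrite /g min_l ?FW.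
have evF : even_fun F.
  rewrite EF -/g; apply: (@even_diff_even _ (0 + size (rcons l b))).
  by apply: even_diff_tower; split=> // y; rewrite /g normrN.
have {}ge : g = fun y => s * expR (F y).
  apply/funext => y; rewrite ge; congr (_ * expR _).
  by case: (ger0P y) => // _; rewrite evF.
rewrite -/g ge in EF; exists F; split=> //.
  (* Bootstrap: the exponential preserves the order, each potential raises it. *)
  elim=> [|n IH]; first by split.
  apply: (@even_diff_leq _ _ (n + size (rcons l b))).
    by rewrite size_rcons addnS ltnS leq_addr.
  rewrite EF; apply: even_diff_tower; apply: even_diff_mul; first exact: even_diff_const.
  exact: even_diff_expR.
by move=> r r0; apply: le_trans (Wdecay r r0); rewrite ler_expR FW.
Qed.

End global_profile.

(** * Radial functions on the Euclidean space *)

Lemma continuous_bigsum (R : realType) (T : topologicalType) (I : Type) (s : seq I)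
    (f : I -> T -> R) (x : T) : (forall i, {for x, continuous (f i)}) ->
  {for x, continuous (fun x => \sum_(i <- s) f i x)}.
Proof.
move=> cf; elim: s => [|i s IH].
  rewrite (_ : (fun _ => _) = fun=> 0); first exact: cst_continuous.
  by apply/funext => y; rewrite big_nil.
rewrite (_ : (fun _ => _) = fun y => f i y + \sum_(j <- s) f j y).
  exact: continuousD.
by apply/funext => y; rewrite big_cons.
Qed.

Section euclidean_norm.
Context (R : realType) (N : nat).
Implicit Types (x : 'rV[R]_N) (i j : 'I_N) (r t : R) (T : \bar R).

Local Notation e_ i := (delta_mx 0 i : 'rV[R]_N).

Lemma sum_sqr_ge0 x : 0 <= \sum_j x 0 j ^+ 2.
Proof. by apply: sumr_ge0 => j _; exact: sqr_ge0. Qed.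

Lemma enorm_ge0 x : 0 <= enorm x.
Proof. exact: sqrtr_ge0. Qed.

Lemma sqr_enorm x : enorm x ^+ 2 = \sum_j x 0 j ^+ 2.
Proof. by rewrite sqr_sqrtr // sum_sqr_ge0. Qed.

Lemma enorm0 : enorm (0 : 'rV[R]_N) = 0.
Proof.
by rewrite /enorm big1 ?sqrtr0 // => j _; rewrite mxE expr0n.
Qed.

Lemma enorm_eq0 x : enorm x = 0 -> x = 0.
Proof.
move=> /(congr1 (fun t => t ^+ 2)); rewrite sqr_enorm expr0n /= => /eqP.
rewrite psumr_eq0 => [/allP x0|j _]; last exact: sqr_ge0.
apply/rowP => j; rewrite mxE; apply/eqP.
by have := x0 j (mem_index_enum j); rewrite sqrf_eq0.
Qed.

Lemma enorm_line x i t :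
  enorm (t *: e_ i + x) = Num.sqrt (enorm x ^+ 2 + 2 * t * x 0 i + t ^+ 2).
Proof.
rewrite {1}/enorm sqr_enorm (bigD1 i) //= [in RHS](bigD1 i) //=; congr Num.sqrt.
rewrite !mxE !eqxx mulr1; under eq_bigr => j ji.
  rewrite !mxE eqxx (negbTE ji) mulr0 add0r; over.
by rewrite /=; ring.
Qed.

Lemma enorm_axis i t : enorm (t *: e_ i) = `|t|.
Proof. by rewrite -[_ *: _]addr0 enorm_line enorm0 mxE mulr0 expr0n !add0r sqrtr_sqr. Qed.

Lemma continuous_enorm : continuous (@enorm R N).
Proof.
move=> x; apply: (@continuous_comp 'rV[R]_N R R (fun x => \sum_j x 0 j ^+ 2) (@Num.sqrt R) x).
  apply: continuous_bigsum => j; apply: (@continuous_comp 'rV[R]_N R R (fun x => x 0 j) (fun t => t ^+ 2) x).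
    exact: coord_continuous.
  exact: exprn_continuous.
exact: sqrt_continuous.
Qed.

Lemma open_eball T : open (@eball R N T).
Proof.
case: T => [t| |].
- have -> : @eball R N t%:E = @enorm R N @^-1` [set r | r < t].
    by apply/seteqP; split => x; rewrite /eball /= lte_fin.
  apply: open_comp; last exact: open_lt.
  by move=> x _; exact: continuous_enorm.
- rewrite (_ : eball _ = setT); first exact: openT.
  by apply/seteqP; split => // x _; rewrite /eball /= ltry.
- rewrite (_ : eball _ = set0); first exact: open0.
  by apply/seteqP; split => // x; rewrite /eball /= ltNge leNye.
Qed.

End euclidean_norm.

Section directional.
Context (R : realType) (V : normedModType R).

Lemma is_derive_line (f : V -> R) x v (df : R) :
  is_derive (0 : R) 1 (fun t => f (t *: v + x)) df -> is_derive x v f df.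
Proof.
move=> [d e]; have dx : derivable f x v by apply/derivable1P.
apply: DeriveDef => //; rewrite -e /derive.
suff -> : (fun h : R => h^-1 *: ((f \o shift x) (h *: v) - f x)) =
   (fun h => h^-1 *: (((fun t => f (t *: v + x)) \o shift 0) (h *: 1) - f (0 *: v + x))).
  by [].
by apply/funext => h /=; rewrite scale0r add0r addr0 /GRing.scale /= mulr1.
Qed.

Lemma is_derive_along_affine (f : V -> R) v y (r df : R) :
  is_derive (r *: v + y) v f df -> is_derive r 1 (fun t => f (t *: v + y)) df.
Proof.
have E : (fun h : R => h^-1 *: ((f \o shift (r *: v + y)) (h *: v) - f (r *: v + y))) =
    (fun h => h^-1 *: (((fun t => f (t *: v + y)) \o shift r) (h *: 1) - f (r *: v + y))).
  by apply/funext => h /=; rewrite scalerDl -addrA /GRing.scale /= mulr1.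
by move=> [d e]; apply: DeriveDef; rewrite /derivable /derive -E.
Qed.

Lemma is_derive_along (f : V -> R) v (r df : R) :
  is_derive (r *: v) v f df -> is_derive r 1 (fun t => f (t *: v)) df.
Proof.
rewrite -{1}[r *: v]addr0 => /is_derive_along_affine.
by congr is_derive; apply/funext => t; rewrite addr0.
Qed.

End directional.

Section radial_functions.
Context (R : realType) (N : nat).
Implicit Types (F G : 'rV[R]_N -> R) (f g : R -> R) (x : 'rV[R]_N) (i j : 'I_N) (r t : R).

Local Notation e_ i := (delta_mx 0 i : 'rV[R]_N).

(** Chain rule on the line through x, where the squared norm is quadratic in t. *)
Lemma is_derive_radial_neq0 f x i (g : R) : x != 0 ->
  is_derive (enorm x) 1 f (enorm x * g) ->
  is_derive x (e_ i) (radial f) (x 0 i * g).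
Proof.
move=> x0 df; apply: is_derive_line; rewrite /radial.
have n0 : enorm x != 0 by apply: contra x0 => /eqP/enorm_eq0 ->.
have np : 0 < enorm x by rewrite lt0r n0 enorm_ge0.
pose p t := enorm x ^+ 2 + 2 * t * x 0 i + t ^+ 2.
have p0 : p 0 = enorm x ^+ 2 by rewrite /p mulr0 mul0r expr0n !addr0.
have dp : is_derive (0 : R) 1 p (2 * x 0 i).
  have d := is_derive_add (is_derive_add (is_derive_const (0 : R) 1 (enorm x ^+ 2))
    (is_derive_cmul (2 * x 0 i) (is_derive_id (0 : R) (1 : R)))) (is_derive_powX 0 2).
  move: d; rewrite /= add0r mulr1 expr1 mulr0 addr0; congr is_derive.
  by apply/funext => t; rewrite /p mulrAC.
have sp : Num.sqrt (p 0) = enorm x by rewrite p0 sqrtr_sqr ger0_norm ?enorm_ge0.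
have ds : is_derive (0 : R) 1 (Num.sqrt \o p) ((2 * Num.sqrt (p 0))^-1 * (2 * x 0 i)).
  by apply: is_derive1_comp dp; apply: is_derive1_sqrt; rewrite p0 exprn_gt0.
have dfs : is_derive ((Num.sqrt \o p) 0) 1 f (enorm x * g) by rewrite /= sp.
have := is_derive1_comp dfs ds; rewrite sp.
have -> : f \o (Num.sqrt \o p) = fun t => f (enorm (t *: e_ i + x)).
  by apply/funext => t; rewrite /= enorm_line.
by move=> /is_derive_eq; apply; field.
Qed.

(** At the origin, evenness turns f(|t|) into f(t). *)
Lemma is_derive_radial f g x i : even_fun f ->
  (forall y : R, is_derive y 1 f (y * g y)) ->
  is_derive x (e_ i) (radial f) (x 0 i * g (enorm x)).
Proof.
move=> ef df; have [->|x0] := eqVneq x 0; last exact: is_derive_radial_neq0.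
apply: is_derive_line; rewrite mxE mul0r.
have := df 0; rewrite mul0r; congr is_derive; apply/funext => t.
by rewrite /radial addr0 enorm_axis; case: (ger0P t).
Qed.

(** A class of functions that contains the radial ones and is stable under partial
    derivatives, at the cost of one order: enough to get all derivatives by
    induction. *)
Inductive radial_algebra : nat -> ('rV[R]_N -> R) -> Prop :=
| RadialProfile n f : even_diff n f -> radial_algebra n (radial f)
| RadialCoord n i : radial_algebra n (fun x => x 0 i)
| RadialMul n F G : radial_algebra n F -> radial_algebra n G ->
    radial_algebra n (fun x => F x * G x)
| RadialAdd n F G : radial_algebra n F -> radial_algebra n G ->
    radial_algebra n (fun x => F x + G x).

Lemma radial_algebra_continuous n F : radial_algebra n F -> continuous F.
Proof.
elim=> {n F} [n f fn|n i|n F G _ cF _ cG|n F G _ cF _ cG] x.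
- apply: continuous_comp; first exact: continuous_enorm.
  exact: even_diff_continuous fn _.
- exact: coord_continuous.
- by apply: continuousM; [exact: cF|exact: cG].
- by apply: continuousD; [exact: cF|exact: cG].
Qed.

Lemma is_derive_coord x i j :
  is_derive x (e_ i) (fun x : 'rV[R]_N => x 0 j) ((i == j)%:R).
Proof.
apply: is_derive_line.
have := is_derive_add (is_derive_cmul ((i == j)%:R) (is_derive_id (0 : R) (1 : R)))
  (is_derive_const (0 : R) 1 (x 0 j)).
rewrite mulr1 addr0; congr is_derive; apply/funext => t.
by rewrite !mxE eqxx eq_sym mulrC.
Qed.

Lemma radial_algebra_derive n F i : radial_algebra n.+1 F ->
  radial_algebra n F /\ exists G, radial_algebra n G /\
    forall x, is_derive x (e_ i) F (G x).
Proof.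
move En: n.+1 => k Fk; elim: Fk n En => {k F}
  [k f fk|k j|k F G _ IF _ IG|k F G _ IF _ IG] n En; subst k.
- split; first exact/RadialProfile/even_diffW.
  have ef := even_diff_even fk; case: fk => _ [g [gn df]].
  exists (fun x => x 0 i * radial g x); split.
    by apply: RadialMul; [exact: RadialCoord|exact: RadialProfile].
  by move=> x; exact: is_derive_radial.
- split; first exact: RadialCoord.
  exists (radial (fun=> (i == j)%:R)); split; last by move=> x; exact: is_derive_coord.
  exact/RadialProfile/even_diff_const.
- have [Fn [F' [F'n dF]]] := IF n erefl; have [Gn [G' [G'n dG]]] := IG n erefl.
  split; first exact: RadialMul.
  exists (fun x => F' x * G x + F x * G' x); split.
    by apply: RadialAdd; exact: RadialMul.
  by move=> x; exact: is_derive_mul.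
- have [Fn [F' [F'n dF]]] := IF n erefl; have [Gn [G' [G'n dG]]] := IG n erefl.
  split; first exact: RadialAdd.
  exists (fun x => F' x + G' x); split; first exact: RadialAdd.
  by move=> x; exact: is_derive_add.
Qed.

Lemma radial_algebra_partials F s n : radial_algebra (size s + n) F ->
  radial_algebra n (foldr (@partial R N) F s).
Proof.
elim: s n F => [//|i s IH] n F /=; rewrite addSn -addnS => /IH Fs.
have [_ [G [Gn dG]]] := radial_algebra_derive i Fs.
by rewrite (_ : partial i _ = G) //; apply/funext => x; rewrite /partial derive_val.
Qed.

Lemma radial_smooth A f : (forall n, even_diff n f) -> smooth_on A (@radial R N f).
Proof.
move=> fn s x _.
have Fs n : radial_algebra n (foldr (@partial R N) (radial f) s).
  exact/radial_algebra_partials/RadialProfile.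
split=> [|i]; first exact: radial_algebra_continuous (Fs 0%N) _.
by have [_ [G [_ /(_ x)[]]]] := radial_algebra_derive i (Fs 1%N).
Qed.

Lemma sum_sqrM x (c : R) : \sum_i (x 0 i * (x 0 i * c)) = enorm x ^+ 2 * c.
Proof. by rewrite sqr_enorm mulr_suml; apply: eq_bigr => i _; rewrite mulrA. Qed.

Lemma laplacian_radial f g h : even_fun f -> even_fun g ->
  (forall y : R, is_derive y 1 f (y * g y)) -> (forall y : R, is_derive y 1 g (y * h y)) ->
  laplacian (@radial R N f) = radial (fun r => N%:R * g r + r ^+ 2 * h r).
Proof.
move=> ef eg df dg; apply/funext => x; rewrite /laplacian.
rewrite (eq_bigr (fun i => g (enorm x) + x 0 i * (x 0 i * h (enorm x)))); last first.
  move=> i _; have -> : partial i (radial f) = fun x => x 0 i * radial g x.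
    apply/funext => z; rewrite /partial.
    by have [_ ->] := is_derive_radial z i ef df.
  have [_ e] := is_derive_mul (is_derive_coord x i i) (is_derive_radial x i eg dg).
  by rewrite /partial e eqxx mul1r.
by rewrite big_split /= sum_sqrM sumr_const card_ord -[_ (enorm x) *+ N]mulr_natl.
Qed.

End radial_functions.

(** * Iterated Laplacians and global radial solutions *)

Section smooth_calculus.
Context (R : realType) (N : nat) (A : set 'rV[R]_N).
Hypothesis oA : open A.
Implicit Types (f g : 'rV[R]_N -> R) (x : 'rV[R]_N) (i j : 'I_N) (l : seq 'I_N).

Local Notation e_ i := (delta_mx 0 i : 'rV[R]_N).

Lemma near_open x : A x -> \near x, A x.
Proof. by move=> Ax; exact: (open_nbhs_nbhs (conj oA Ax)). Qed.

Lemma near_eq_on f g x : (forall y, A y -> f y = g y) -> A x -> \near x, f x = g x.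
Proof. by move=> fg Ax; near=> y; apply: fg; near: y; exact: near_open.
Unshelve. all: by end_near. Qed.

Lemma eq_on_partial f g x i : (forall y, A y -> f y = g y) -> A x ->
  partial i f x = partial i g x.
Proof. by move=> fg Ax; apply: near_eq_derive; exact: near_eq_on. Qed.

Lemma eq_on_laplacian f g x : (forall y, A y -> f y = g y) -> A x ->
  laplacian f x = laplacian g x.
Proof.
move=> fg Ax; apply: eq_bigr => i _; apply: eq_on_partial => // y Ay.
exact: eq_on_partial.
Qed.

Lemma smooth_on_is_derive f x i : smooth_on A f -> A x ->
  is_derive x (e_ i) f (partial i f x).
Proof. by move=> sf Ax; apply: derivableP; have [_ /(_ i)] := sf [::] x Ax. Qed.

Lemma smooth_on_continuous f x : smooth_on A f -> A x -> {for x, continuous f}.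
Proof. by move=> sf Ax; have [] := sf [::] x Ax. Qed.

Lemma smooth_on_partial f i : smooth_on A f -> smooth_on A (partial i f).
Proof.
move=> sf l x Ax; have := sf (rcons l i) x Ax.
by rewrite -cats1 foldr_cat.
Qed.

Lemma foldr_partial_linear f g (s t : R) l x : smooth_on A f -> smooth_on A g -> A x ->
  foldr (@partial R N) (fun y => s * f y + t * g y) l x =
  s * foldr (@partial R N) f l x + t * foldr (@partial R N) g l x.
Proof.
move=> sf sg; elim: l x => //= i l IH x Ax.
rewrite (eq_on_partial _ IH Ax).
have [_ /(_ i)/derivableP df] := sf l x Ax.
have [_ /(_ i)/derivableP dg] := sg l x Ax.
by have [_] := is_derive_add (is_derive_cmul s df) (is_derive_cmul t dg).
Qed.

Lemma smooth_on_linear f g (s t : R) : smooth_on A f -> smooth_on A g ->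
  smooth_on A (fun y => s * f y + t * g y).
Proof.
move=> sf sg l x Ax.
pose G y := s * foldr (@partial R N) f l y + t * foldr (@partial R N) g l y.
have E : \near x, G x = foldr (@partial R N) (fun y => s * f y + t * g y) l x.
  by apply: near_eq_on Ax => y Ay; rewrite foldr_partial_linear.
have [cf df] := sf l x Ax; have [cg dg] := sg l x Ax.
split.
  rewrite /prop_for /continuous_at -(nbhs_singleton E); apply: cvg_trans (near_eq_cvg E) _.
  by apply: cvgD; apply: cvgMr.
move=> i; apply: near_eq_derivable E _.
by have [] := is_derive_add (is_derive_cmul s (derivableP (df i)))
  (is_derive_cmul t (derivableP (dg i))).
Qed.

Lemma smooth_on_laplacian f : smooth_on A f -> smooth_on A (laplacian f).
Proof.
move=> sf; suff H (s : seq 'I_N) :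
    smooth_on A (fun x => \sum_(i <- s) partial i (partial i f) x) by exact: H.
elim: s => [|i s IH].
  have := smooth_on_linear 0 0 sf sf; congr smooth_on.
  by apply/funext => y; rewrite big_nil !mul0r addr0.
have := smooth_on_linear 1 1 (smooth_on_partial i (smooth_on_partial i sf)) IH.
by congr smooth_on; apply/funext => y; rewrite big_cons !mul1r.
Qed.

Lemma smooth_on_iter_laplacian f k : smooth_on A f ->
  smooth_on A (iter k (@laplacian R N) f).
Proof.
move=> sf; elim: k => [|k IH]; first exact: sf.
by rewrite iterS; exact: smooth_on_laplacian IH.
Qed.

Lemma laplacianZ f (c : R) x : smooth_on A f -> A x ->
  laplacian (fun y => c * f y) x = c * laplacian f x.
Proof.
move=> sf Ax; rewrite /laplacian mulr_sumr; apply: eq_bigr => i _.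
have := foldr_partial_linear c 0 [:: i; i] sf sf Ax.
rewrite /= mul0r addr0 => <-.
by congr (partial i (partial i _) x); apply/funext => y; rewrite mul0r addr0.
Qed.

Lemma iter_neg_laplacian f k x : smooth_on A f -> A x ->
  iter k (fun g y => - laplacian g y) f x = (-1) ^+ k * iter k (@laplacian R N) f x.
Proof.
move=> sf; elim: k x => [|k IH] x Ax; first by rewrite expr0 mul1r.
rewrite iterS (eq_on_laplacian IH Ax) laplacianZ //; last exact: smooth_on_iter_laplacian.
by rewrite exprS -!mulrA mulN1r.
Qed.

End smooth_calculus.

Section radial_profiles.
Context (R : realType) (N : nat).
Implicit Types (f g v : R -> R) (r a b : R) (k m n : nat) (l : seq R).

Local Notation e_ i := (delta_mx 0 i : 'rV[R]_N).

(** The average g = average (N-1) v satisfies (y^N g)' = y^(N-1) v, that is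
    N g + y g' = v. *)
Lemma laplacian_radial_potential a v : (0 < N)%N -> (forall n, even_diff n v) ->
  laplacian (@radial R N (fun y => a + radial_potential N v y)) = radial v.
Proof.
move=> N0 vn; have cv := even_diff_continuous (vn 0%N).
have [_ [v1 [v1n dv]]] := vn 1%N; have [_ cv1] := v1n.
have dg y := is_derive_average N.-1 y cv cv1 dv.
have df (y : R) : is_derive y 1 (fun y => a + radial_potential N v y) (y * average N.-1 v y).
  rewrite -[X in is_derive _ _ _ X]add0r.
  exact: is_derive_add (is_derive_const _ _ _) (is_derive_radial_potential _ _ cv).
have ev := even_diff_even (vn 0%N).
have ep : even_fun (fun y => a + radial_potential N v y).
  by move=> y; rewrite (even_diff_even (even_diff_potential N (vn 0%N))).
rewrite (@laplacian_radial R N _ _ _ ep (even_average N.-1 cv ev) df dg).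
congr radial; apply/funext => y; have [->|y0] := eqVneq y 0.
  rewrite /average eqxx expr0n mul0r addr0 prednK // mulrC divfK //.
  by rewrite pnatr_eq0 -lt0n.
have [_ e1] := dg y; have [_ e2] := is_derive_average_neq0 N.-1 cv y0.
have {e1 e2} e : y * average N.-1.+2 v1 y = (v y - N%:R * average N.-1 v y) / y.
  by rewrite -e1 e2 prednK.
by rewrite expr2 -mulrA e [y * _]mulrC divfK // addrC subrK.
Qed.

Lemma iter_laplacian_tower l v k : (0 < N)%N -> (forall n, even_diff n v) ->
  (k <= size l)%N ->
  iter k (@laplacian R N) (radial (tower N l v)) = radial (tower N (drop k l) v).
Proof.
move=> N0 vn; elim: k => [|k IH] kl; first by rewrite drop0.
rewrite iterS IH 1?ltnW // (drop_nth 0 kl) /= laplacian_radial_potential // => n.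
by apply: even_diff_leq (even_diff_tower N (drop k.+1 l) (vn n)); rewrite leq_addr.
Qed.

Lemma derive1n_axis (f : 'rV[R]_N -> R) i k :
  derive1n k (fun r => f (r *: e_ i)) =
  fun r => foldr (@partial R N) f (nseq k i) (r *: e_ i).
Proof.
elim: k => // k IH; rewrite derive1nS IH; apply/funext => r.
rewrite /derive1 /= /partial /derive.
suff -> : (fun h => h^-1 *: (foldr (@partial R N) f (nseq k i) ((h + r) *: e_ i) -
    foldr (@partial R N) f (nseq k i) (r *: e_ i))) = (fun h => h^-1 *: ((foldr
    (@partial R N) f (nseq k i) \o shift (r *: e_ i)) (h *: e_ i) -
    foldr (@partial R N) f (nseq k i) (r *: e_ i))) by [].
by apply/funext => h /=; rewrite scalerDl.
Qed.

(** Derivatives of odd order of an even function are odd. *)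
Lemma even_odd_derive0 f k : (0 < N)%N -> (forall n, even_diff n f) ->
  derive1n k.*2.+1 (fun r => f `|r|) 0 = 0.
Proof.
move=> N0 fn; have ef := even_diff_even (fn 0%N).
have i : 'I_N by exact: Ordinal N0.
pose p (r : R) := radial f (r *: e_ i).
have -> : (fun r => f `|r|) = p by apply/funext => r; rewrite /p /radial enorm_axis.
have dp j r : derivable (derive1n j p) r 1.
  have [_ /(_ i)/derivableP d] :=
    @radial_smooth R N setT f fn (nseq j i) (r *: e_ i) I.
  by rewrite derive1n_axis; have [] := is_derive_along d.
have par j r : derive1n j p (- r) = (-1) ^+ j * derive1n j p r.
  elim: j r => [|j IH] r; first by rewrite mul1r !derive1n0 /p /radial !enorm_axis normrN.
  rewrite derive1nS !derive1E.
  have d1 : is_derive r 1 (derive1n j p \o -%R) ('D_1 (derive1n j p) (- r) * -1).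
    apply: is_derive1_comp; exact: derivableP.
  have d2 := is_derive_cmul ((-1) ^+ j) (derivableP (dp j r)).
  have E : derive1n j p \o -%R = fun r => (-1) ^+ j * derive1n j p r.
    by apply/funext => z; rewrite /= IH.
  rewrite E in d1; have := @derive_val _ _ _ _ _ _ _ d1; rewrite (@derive_val _ _ _ _ _ _ _ d2).
  by rewrite exprS mulN1r mulNr => ->; rewrite mulrN1 opprK.
have := par k.*2.+1 0; rewrite oppr0 -signr_odd /= odd_double expr1 mulN1r; lra.
Qed.

Lemma global_radial_solution m (a : 'I_m.-1 -> R) b f : (0 < N)%N -> (0 < m)%N ->
  (forall n, even_diff n f) ->
  f = tower N (rcons [seq a i | i <- enum 'I_m.-1] b) (fun y => (-1) ^+ m * expR (f y)) ->
  @radial_solution R N m a b +oo%E f.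
Proof.
move=> N0 m0 fn fE; set v : R -> R := fun y => _ * _ in fE; set l := rcons _ _ in fE.
have vn n : even_diff n v.
  by apply: even_diff_mul; [exact: even_diff_const|exact: even_diff_expR].
have cv := even_diff_continuous (vn 0%N).
have sl : size l = m by rewrite size_rcons size_map -cardE card_ord prednK.
have sf A : smooth_on A (@radial R N f) by exact: radial_smooth.
have lapf k : (k <= m)%N ->
    iter k (@laplacian R N) (radial f) = radial (tower N (drop k l) v).
  by move=> km; rewrite {1}fE iter_laplacian_tower // sl.
have lap0 k : (k < m)%N -> iter k (@laplacian R N) (radial f) 0 = nth 0 l k.
  move=> km; rewrite lapf 1?ltnW // /radial enorm0 (drop_nth 0) ?sl // tower0 //.
split => //.
- move=> x Tx; rewrite (iter_neg_laplacian (@open_eball R N +oo%E)) // lapf //.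
  by rewrite drop_oversize ?sl // /radial /= /v mulrA -exprMn mulrNN mulr1 expr1n mul1r.
- by move=> k _; exact: even_odd_derive0.
split => [k|].
  rewrite lap0; last by rewrite (leq_trans (ltn_ord k)) // leq_pred.
  rewrite nth_rcons size_map -cardE card_ord ltn_ord (nth_map k) ?nth_ord_enum //.
  by rewrite -cardE card_ord.
rewrite lap0 ?prednK // nth_rcons size_map -cardE card_ord ltnn eqxx //.
Qed.

End radial_profiles.

(** * Uniqueness of radial solutions *)

Section uniqueness.
Context (R : realType) (N : nat).
Hypothesis N1 : (1 < N)%N.
Implicit Types (F : 'rV[R]_N -> R) (r rho b : R) (k n : nat) (l : seq R) (T : \bar R).

Local Notation e_ i := (delta_mx 0 i : 'rV[R]_N).

Let N0 : (0 < N)%N := ltnW N1.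

Lemma eball_axis T i r : eball T (r *: e_ i) = (`|r|%:E < T)%E.
Proof. by rewrite /eball /= enorm_axis. Qed.

(** Off the origin F is v(|x|) for a C^2 function v, so the chain rule expresses its
    Laplacian through |x| alone; this is the radial equation with a = v'/r. *)
Lemma radial_on_ball_laplacian T F i : (0 < T)%E -> smooth_on (eball T) F ->
  (forall x, eball T x -> F x = F (enorm x *: e_ i)) ->
  (forall x, eball T x -> laplacian F x = laplacian F (enorm x *: e_ i)) /\
  forall rho, (rho%:E <= T)%E -> has_radial_laplacian N rho
    (fun r => F (r *: e_ i)) (fun r => laplacian F (r *: e_ i)).
Proof.
move=> T0 sF radF; have oT := @open_eball R N T.
pose v r := F (r *: e_ i); pose w r := partial i F (r *: e_ i).
pose w1 r := partial i (partial i F) (r *: e_ i).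
have dv r : (`|r|%:E < T)%E -> is_derive r 1 v (w r).
  by move=> rT; apply: is_derive_along; apply: smooth_on_is_derive sF _; rewrite eball_axis.
have dw r : (`|r|%:E < T)%E -> is_derive r 1 w (w1 r).
  move=> rT; apply: is_derive_along.
  by apply: smooth_on_is_derive (smooth_on_partial i sF) _; rewrite eball_axis.
pose a r := w r / r; pose h r := (w1 r - a r) / r ^+ 2.
have wa r : r != 0 -> w r = r * a r by move=> r0; rewrite /a mulrC divfK.
have da r : r != 0 -> (`|r|%:E < T)%E -> is_derive r 1 a (r * h r).
  move=> r0 rT; apply: is_derive_eq (is_derive_mul (dw r rT)
    (@is_derive_inv _ _ id r 1 _ r0 (is_derive_id r 1))) _.
  by rewrite /h /a; field.
have lapE x : x != 0 -> eball T x ->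
    laplacian F x = N%:R * a (enorm x) + enorm x ^+ 2 * h (enorm x).
  move=> x0 xT; rewrite /laplacian.
  have part j y : y != 0 -> eball T y -> partial j F y = y 0 j * radial a y.
    move=> y0 yT; rewrite (eq_on_partial oT j (g := radial v) radF yT).
    have n0 : enorm y != 0 by apply: contra y0 => /eqP/enorm_eq0 ->.
    have yT' : (`|enorm y|%:E < T)%E by rewrite ger0_norm ?enorm_ge0.
    have d : is_derive (enorm y) 1 v (enorm y * a (enorm y)) by rewrite -wa //; exact: dv.
    by have [_ ] := is_derive_radial_neq0 j y0 d.
  pose A : set 'rV[R]_N := eball T `&` [set x | 0 < enorm x].
  have oA : open A.
    apply: openI => //; apply: (@open_comp _ _ (@enorm R N) [set r | 0 < r]).
      by move=> y _; exact: continuous_enorm.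
    exact: open_gt.
  have xA : A x.
    by split=> //=; rewrite lt0r enorm_ge0 andbT; apply: contra x0 => /eqP/enorm_eq0 ->.
  rewrite (eq_bigr (fun j => a (enorm x) + x 0 j * (x 0 j * h (enorm x)))); last first.
    move=> j _.
    rewrite (@eq_on_partial R N A oA _ (fun y => y 0 j * radial a y)) //; last first.
      move=> y [yT y0]; apply: part => //; apply: contraTneq y0 => ->.
      by rewrite /= enorm0 ltxx.
    have xT' : (`|enorm x|%:E < T)%E by rewrite ger0_norm ?enorm_ge0.
    have n0 : enorm x != 0 by apply: contra x0 => /eqP/enorm_eq0 ->.
    have [_ e] := is_derive_mul (is_derive_coord x j j)
      (is_derive_radial_neq0 j x0 (da _ n0 xT')).
    by rewrite /partial e eqxx mul1r.
  by rewrite big_split /= sum_sqrM sumr_const card_ord -[_ (enorm x) *+ N]mulr_natl.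
have axis0 r : r != 0 -> r *: e_ i != 0.
  move=> r0; apply/eqP => /(congr1 (@enorm R N)); rewrite enorm_axis enorm0 => /eqP.
  by rewrite normr_eq0 (negbTE r0).
split=> [x xT|rho rhoT].
  have [->|x0] := eqVneq x 0; first by rewrite enorm0 scale0r.
  have n0 : enorm x != 0 by apply: contra x0 => /eqP/enorm_eq0 ->.
  rewrite !lapE ?axis0 // ?eball_axis ?enorm_axis ger0_norm ?enorm_ge0 //.
have inT r : 0 <= r < rho -> (`|r|%:E < T)%E.
  by move=> /andP[r0 rrho]; rewrite ger0_norm // (lt_le_trans _ rhoT).
have posT r : 0 < r < rho -> r != 0 /\ (`|r|%:E < T)%E.
  by move=> /andP[r0 rrho]; rewrite gt_eqF // inT // ltW.
split; first by move=> r /inT /dv /is_derive_continuous.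
exists a; split=> [r /posT[r0 rT]|r /[dup] /andP[rp _] /posT[r0 rT]|].
- by rewrite -wa //; exact: dv.
- rewrite lapE ?axis0 ?eball_axis // enorm_axis gtr0_norm //.
  apply: is_derive_eq (is_derive_mul (is_derive_powX r N) (da r r0 rT)) _.
  by rewrite -{3}(prednK N0) exprS; ring.
- have -> : (fun r => r ^+ N * a r) = fun r => r ^+ N.-1 * w r.
    apply/funext => r; have [->|r0] := eqVneq r 0; last first.
      by rewrite wa // mulrA -exprSr prednK.
    have N1' : (N.-1 == 0)%N = false by apply/negbTE; rewrite -lt0n -subn1 subn_gt0.
    by rewrite !expr0n (gtn_eqF N0) N1' !mul0r.
  apply: (@continuousM _ _ (fun r => r ^+ N.-1) w); first exact: exprn_continuous.
  by apply: is_derive_continuous (dw 0 _); rewrite normr0.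
Qed.

(** The iterated Laplacians of both solutions are linked by radial Poisson equations
    and start from the same values at 0, so their differences contract in the
    Gaussian weighted norm on any compact subinterval of [0, T[. *)
Lemma radial_solution_unique m (a : 'I_m.-1 -> R) b T (u f : R -> R) : (0 < m)%N ->
  (forall n, even_diff n f) ->
  f = tower N (rcons [seq a i | i <- enum 'I_m.-1] b) (fun y => (-1) ^+ m * expR (f y)) ->
  @radial_solution R N m a b T u ->
  forall r, 0 <= r -> (r%:E < T)%E -> u r = f r.
Proof.
move=> m0 fn fE uT r r0 rT; set l := rcons _ _ in fE.
set V : R -> R := fun y => _ * _ in fE.
have Vn n : even_diff n V.
  by apply: even_diff_mul; [exact: even_diff_const|exact: even_diff_expR].
have cV := even_diff_continuous (Vn 0%N).
have sl : size l = m by rewrite size_rcons size_map -cardE card_ord prednK.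
have [T0 su eqn _ [au bu]] := uT.
have i : 'I_N by exact: Ordinal N0.
have oT := @open_eball R N T.
pose L k := iter k (@laplacian R N) (radial u).
have sL k : smooth_on (eball T) (L k) by exact: smooth_on_iter_laplacian.
have Lrad k x : eball T x -> L k x = L k (enorm x *: e_ i).
  elim: k x => [|k IH] x xT; last by have [H _] := radial_on_ball_laplacian T0 (sL k) IH; exact: H.
  by rewrite /L /= /radial enorm_axis ger0_norm // enorm_ge0.
have [rho rrho rhoT] : exists2 rho, r < rho & (rho%:E < T)%E.
  case: T T0 rT {uT su eqn oT sL Lrad} => [t| |] //= _.
    by rewrite lte_fin => rt; exists ((r + t) / 2); rewrite ?lte_fin; lra.
  by move=> _; exists (r + 1); rewrite ?ltrDl // ltry.
pose d k s := L k (s *: e_ i) - tower N (drop k l) V s.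
have dL k : (k < m)%N -> has_radial_laplacian N rho (d k) (d k.+1).
  move=> km; have [_ /(_ rho (ltW rhoT)) hL] := radial_on_ball_laplacian T0 (sL k) (@Lrad k).
  have ct : continuous (tower N (drop k.+1 l) V) by exact: continuous_tower.
  have hU := radial_laplacian_linear (l`_k) 1 (radial_laplacian_const N0 rho 1)
     (radial_laplacian_potential N0 rho ct).
  have := radial_laplacian_linear 1 (-1) hL hU.
  congr has_radial_laplacian; apply/funext => s; rewrite /d.
    by rewrite (drop_nth 0 (_ : k < size l)%N) ?sl //=; ring.
  by rewrite /L iterS; ring.
have d0 k : (k < m)%N -> d k 0 = 0.
  move=> km; rewrite /d scale0r (drop_nth 0) ?sl // tower0 //; apply/eqP.
  rewrite subr_eq0; apply/eqP; rewrite nth_rcons size_map -cardE card_ord.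
  have [km1|mk] := ltnP k m.-1.
    rewrite (nth_map (Ordinal km1)) -?cardE ?card_ord //.
    rewrite (_ : nth _ _ k = Ordinal km1) -?(au (Ordinal km1)) //.
    by apply: val_inj; rewrite /= nth_enum_ord.
  have -> : k = m.-1 by apply/eqP; rewrite eqn_leq mk andbT -ltnS prednK.
  by rewrite eqxx /L bu.
have sT s : 0 <= s <= rho -> eball T (s *: e_ i).
  move=> /andP[s0 sr]; rewrite eball_axis ger0_norm //.
  by rewrite (le_lt_trans _ rhoT).
have rho0 : 0 <= rho by rewrite (le_trans r0) // ltW.
have cd k s : 0 <= s <= rho -> {for s, continuous (d k)}.
  move=> sr; apply: continuousB; last exact: continuous_tower.
  exact: is_derive_continuous (is_derive_along (smooth_on_is_derive i (sL k) (sT s sr))).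
have bounded (g : R -> R) : (forall s, 0 <= s <= rho -> {for s, continuous g}) ->
    exists2 D, 0 <= D & forall s, 0 <= s <= rho -> `|g s| <= D.
  move=> cg; suff [c _ cmax] : exists2 c, c \in `[0, rho]%R &
      forall z, z \in `[0, rho]%R -> `|g z| <= `|g c|.
    by exists `|g c| => // s sr; apply: cmax; rewrite in_itv.
  apply: (@EVT_max R (fun z => `|g z|)) => //.
  apply: continuous_in_subspaceT => z; rewrite inE /= in_itv /= => zr.
  by apply: continuous_comp; [exact: cg|exact: norm_continuous].
have [M M0 [uM fM]] : exists2 M, 0 <= M & (forall s, 0 <= s <= rho -> u s <= M) /\
    (forall s, 0 <= s <= rho -> f s <= M).
  have [|D1 D10 dD] := bounded (d 0%N); first by move=> s; exact: cd.
  have cf := even_diff_continuous (fn 0%N).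
  have [|D2 D20 fD] := bounded f; first by move=> s _; exact: cf.
  exists (D1 + D2); first exact: addr_ge0.
  split=> s sr; last by have := le_trans (ler_norm _) (fD s sr); lra.
  have := dD s sr; rewrite /d drop0 -fE /L /= /radial enorm_axis.
  have /andP[s0 _] := sr; rewrite (ger0_norm s0).
  have := le_trans (ler_norm _) (fD s sr).
  by move=> ? /(le_trans (ler_norm _)); lra.
have dm s : 0 <= s < rho -> `|d m s| <= expR M * `|d 0%N s|.
  move=> /andP[s0 sr]; have sr' : 0 <= s <= rho by rewrite s0 ltW.
  have := eqn _ (sT s sr'); rewrite (iter_neg_laplacian oT) //; last exact: sT.
  rewrite -/(L m) /radial enorm_axis (ger0_norm s0) => em.
  have L0 : L 0%N (s *: e_ i) = u s by rewrite /L /= /radial enorm_axis ger0_norm.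
  rewrite /d drop_oversize ?sl // drop0 -fE L0 /L /=.
  have -> : iter m (@laplacian R N) (radial u) (s *: e_ i) = (-1) ^+ m * expR (u s).
    by rewrite -em mulrA -exprMn mulrNN mulr1 expr1n mul1r.
  rewrite /V -mulrBr normrM normrX normrN1 expr1n mul1r.
  have := expR_min_lipschitz (u s) (f s) (lexx M).
  by rewrite !min_l ?uM ?fM.
have [D D0 dD] : exists2 D, 0 <= D & forall k, (k <= m)%N -> forall s, 0 <= s <= rho -> `|d k s| <= D.
  elim: (m) => [|n [D D0 IH]].
    have [|D D0 H] := bounded (d 0%N); first by move=> s; exact: cd.
    by exists D => // k; rewrite leqn0 => /eqP ->.
  have [|D' D'0 H] := bounded (d n.+1); first by move=> s; exact: cd.
  exists (D + D'); first exact: addr_ge0.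
  move=> k; rewrite leq_eqVlt => /predU1P[-> s /H|kn s sr].
    by move=> /le_trans; apply; rewrite lerDr.
  by apply: (le_trans (IH k kn s sr)); rewrite lerDl.
pose lam := expR M + 1; have lam0 : 0 < lam by rewrite /lam; have := expR_gt0 M; lra.
have E1 s : 1 <= expR (lam * s ^+ 2).
  by rewrite -expR0 ler_expR mulr_ge0 ?sqr_ge0 // ltW.
(* The bound D can be halved for all k at once: for k < m by the Gaussian weight,
   and for k = m because d m is controlled by d 0. *)
have claim n : forall k, (k <= m)%N -> forall s, 0 <= s < rho ->
    `|d k s| <= D / 2 ^+ n * expR (lam * s ^+ 2).
  elim: n => [|n IH] k km s /andP[s0 sr].
    rewrite expr0 divr1 (le_trans (dD k km s _)) ?s0 ?(ltW sr) //.
    by rewrite ler_peMr.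
  have Dn : 0 <= D / 2 ^+ n by rewrite divr_ge0 // exprn_ge0.
  have step j t : (j < m)%N -> 0 <= t < rho ->
      `|d j t| <= D / 2 ^+ n / (2 * lam) * expR (lam * t ^+ 2).
    move=> jm tr; apply: (gaussian_weight_bound N0 lam0 Dn (dL j jm) (d0 j jm)) => //.
    by move=> q /andP[q0 qr]; apply: IH => //; rewrite (ltW q0).
  have [->|k_m] := eqVneq k m.
    apply: (le_trans (dm s _)); first by rewrite s0.
    apply: (@le_trans _ _ (expR M * (D / 2 ^+ n / (2 * lam) * expR (lam * s ^+ 2)))).
      by rewrite ler_wpM2l ?expR_ge0 // step // s0.
    have -> : D / 2 ^+ n.+1 = D / 2 ^+ n / 2 by rewrite exprSr invfM mulrA.
    rewrite mulrA ler_wpM2r ?expR_ge0 //.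
    rewrite mulrCA ler_wpM2l // ler_pdivrMr ?mulr_gt0 // mulrA mulVf // mul1r.
    by rewrite /lam lerDl.
  have km' : (k < m)%N by rewrite ltn_neqAle k_m km.
  apply: (le_trans (step k s km' _)); first by rewrite s0.
  have -> : D / 2 ^+ n.+1 = D / 2 ^+ n / 2 by rewrite exprSr invfM mulrA.
  rewrite ler_wpM2r ?expR_ge0 // ler_wpM2l //.
  by rewrite lef_pV2 ?posrE ?mulr_gt0 // ler_peMr // /lam lerDr expR_ge0.
have : `|d 0%N r| <= 0.
  apply/ler_addgt0Pr => e e0; rewrite add0r.
  have [n ne] := geometric_small (mulr_ge0 D0 (expR_ge0 (lam * r ^+ 2))) e0.
  apply: le_trans ne; rewrite mulrAC; apply: claim => //.
  by rewrite r0.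
rewrite normr_le0 /d drop0 -fE /L /= /radial enorm_axis ger0_norm // subr_eq0.
by move/eqP.
Qed.

End uniqueness.

(** * Lebesgue integration on tuples *)

Section bounded_support.
Context (R : realType) (d : measure_display) (T : measurableType d).

Lemma bounded_support_integrable (mu : {measure set T -> \bar R}) (B : set T)
    (g : T -> R) (C : R) : measurable B -> (mu B < +oo)%E ->
  measurable_fun setT g -> (forall x, `|g x| <= C) -> (forall x, g x != 0 -> B x) ->
  mu.-integrable setT (EFin \o g).
Proof.
move=> mB Boo mg gC gB.
have -> : EFin \o g = (EFin \o g) \_ B.
  apply/funext => x; rewrite patchE; case: ifPn => // /negP xB /=.
  by have [->//|/gB Bx] := eqVneq (g x) 0; exfalso; apply: xB; rewrite inE.
apply/(integrable_mkcond _ mB); apply: measurable_bounded_integrable => //.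
  exact: measurable_funTS.
exists C; split; first exact: num_real.
by move=> M CM x _; apply: le_trans (gC x) (ltW CM).
Qed.

End bounded_support.

Section tuple_integrals.
Context (R : realType).
Local Notation RR := (measurableTypeR R).
Local Notation mu n := (lebesgue_measure_tuple R n).
Implicit Types (n : nat) (M C : R).

Definition tuple_box n M : set (n.-tuple RR) := [set x | forall i, `|tnth x i| <= M].
Arguments tuple_box : clear implicits.

Lemma measurable_tuple_box n M : measurable (tuple_box n M).
Proof.
have -> : tuple_box n M =
    \bigcap_(i in [set: 'I_n]) ((fun x : n.-tuple RR => tnth x i) @^-1` `[- M, M]%classic).
  apply/seteqP; split=> x /= H i; first by move=> _; rewrite /= in_itv /= -ler_norml.
  by have := H i I; rewrite /= in_itv /= -ler_norml.
apply: fin_bigcap_measurable => [|i _]; first exact: finite_finset.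
by rewrite -[X in measurable X]setTI; apply: measurable_tnth => //; exact: measurable_itv.
Qed.

Lemma interval_lty M : (@lebesgue_measure R `[(- M)%R, M]%classic < +oo)%E.
Proof. by rewrite lebesgue_measure_itv /=; case: ifP => // _; rewrite -EFinB ltry. Qed.

Lemma tuple_cons_box n M :
  tuple_cons (n := n) @^-1` tuple_box n.+1 M = `[- M, M]%classic `*` tuple_box n M.
Proof.
apply/seteqP; split=> -[t x] /=.
  move=> H; split=> [|i]; first by have := H ord0; rewrite tnth0 /= in_itv /= -ler_norml.
  by have := H (lift ord0 i); rewrite tnthS.
rewrite in_itv /= -ler_norml => -[tM xM] i.
by case: (unliftP ord0 i) => [j ->|->]; rewrite ?tnthS ?tnth0 //; exact: xM.
Qed.

Lemma tuple_box_lty n M : (mu n (tuple_box n M) < +oo)%E.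
Proof.
elim: n => [|n IH]; first by rewrite /= diracE ltry.
change ((@lebesgue_measure R \x mu n) (tuple_cons (n := n) @^-1` tuple_box n.+1 M) < +oo)%E.
rewrite tuple_cons_box product_measure1E; [|exact: measurable_itv|exact: measurable_tuple_box].
by rewrite lte_mul_pinfty // ?ge0_fin_numE ?interval_lty.
Qed.

Definition box_bounded n (g : n.-tuple RR -> R) :=
  measurable_fun setT g /\ exists M C,
    (forall x, `|g x| <= C) /\ (forall x, g x != 0 -> tuple_box n M x).

Lemma box_bounded_integrable n (g : n.-tuple RR -> R) : box_bounded g ->
  (mu n).-integrable setT (EFin \o g).
Proof.
move=> [mg [M [C [gC gM]]]].
apply: (@bounded_support_integrable R _ _ (mu n) (tuple_box n M) g C) => //.
  exact: measurable_tuple_box.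
exact: tuple_box_lty.
Qed.

Lemma box_bounded_slice n (g : n.+1.-tuple RR -> R) (t : RR) : box_bounded g ->
  box_bounded (fun x : n.-tuple RR => g (tuple_cons (t, x))).
Proof.
move=> [mg [M [C [gC gM]]]]; split.
  apply: (measurableT_comp mg (g := fun x => tuple_cons (t, x))).
  apply: (measurableT_comp (@measurable_tuple_cons R n) (g := pair t)).
  exact: pair1_measurable.
exists M, C; split=> [x|x /gM H i]; first exact: gC.
by have := H (lift ord0 i); rewrite tnthS.
Qed.

Lemma integral_tuple_cons n (g : n.+1.-tuple RR -> R) : box_bounded g ->
  (\int[mu n.+1]_x (g x)%:E =
     \int[@lebesgue_measure R]_t \int[mu n]_x (g (tuple_cons (t, x)))%:E)%E /\
  (\int[mu n.+1]_x (g x)%:E =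
     \int[mu n]_x \int[@lebesgue_measure R]_t (g (tuple_cons (t, x)))%:E)%E.
Proof.
move=> [mg [M [C [gC gM]]]].
have mc := @measurable_tuple_cons R n.
have mgc : measurable_fun setT (fun p => g (tuple_cons (n := n) p)).
  exact: (measurableT_comp mg mc).
have ip : ((@lebesgue_measure R \x mu n)%E).-integrable setT
    (EFin \o (fun p => g (tuple_cons (n := n) p))).
  apply: (@bounded_support_integrable R _ _ (@lebesgue_measure R \x mu n)%E
    (`[- M, M]%classic `*` tuple_box n M) (fun p => g (tuple_cons (n := n) p)) C) => //.
  - by apply: measurableX; [exact: measurable_itv|exact: measurable_tuple_box].
  - rewrite /= product_measure1E; [|exact: measurable_itv|exact: measurable_tuple_box].
    by rewrite lte_mul_pinfty // ?ge0_fin_numE ?interval_lty // tuple_box_lty.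
  - by move=> p /gM; rewrite -tuple_cons_box.
have E : (\int[mu n.+1]_x (g x)%:E =
    \int[(@lebesgue_measure R \x mu n)%E]_p (g (tuple_cons (n := n) p))%:E)%E.
  change (\int[pushforward (@lebesgue_measure R \x mu n) (tuple_cons (n := n))]_x (g x)%:E =
    \int[(@lebesgue_measure R \x mu n)%E]_p (g (tuple_cons (n := n) p))%:E)%E.
  rewrite (@integral_pushforward _ _ _ _ R _ mc _ setT (EFin \o g)) //.
    exact/measurable_EFinP.
rewrite E; split.
  by rewrite -(integral12_prod_meas1 ip).
by rewrite -(integral21_prod_meas1 ip).
Qed.

Definition set_coord n (x : n.-tuple RR) (i : 'I_n) (t : RR) : n.-tuple RR :=
  [tuple if j == i then t else tnth x j | j < n].

Lemma set_coord0 n s (x : n.-tuple RR) t :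
  set_coord (tuple_cons (s, x)) ord0 t = tuple_cons (t, x).
Proof.
apply: eq_from_tnth => j; rewrite tnth_mktuple.
by case: (unliftP ord0 j) => [k ->|->]; rewrite ?tnthS ?eqxx ?tnth0 //.
Qed.

Lemma set_coordS n s (x : n.-tuple RR) i t :
  set_coord (tuple_cons (s, x)) (lift ord0 i) t = tuple_cons (s, set_coord x i t).
Proof.
apply: eq_from_tnth => j; rewrite tnth_mktuple.
case: (unliftP ord0 j) => [k ->|->]; last by rewrite !tnth0.
by rewrite !tnthS tnth_mktuple (inj_eq lift_inj).
Qed.

(** Fubini, with the i-th coordinate as the innermost variable. *)
Lemma integral_coord_zero n (i : 'I_n) (g : n.-tuple RR -> R) : box_bounded g ->
  (forall x, \int[@lebesgue_measure R]_t (g (set_coord x i t))%:E = 0)%E ->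
  (\int[mu n]_x (g x)%:E = 0)%E.
Proof.
elim: n i g => [[] //|n IH] i g bg g0; have [E1 E2] := integral_tuple_cons bg.
move: g0; case: (unliftP ord0 i) => [j ->|->] g0.
- rewrite E1; apply: integral0_eq => t _.
  apply: (IH j _ (box_bounded_slice t bg)) => x; rewrite -(g0 (tuple_cons (t, x))).
  by apply: eq_integral => s _; rewrite set_coordS.
- rewrite E2; apply: integral0_eq => x _; rewrite -(g0 (tuple_cons (0, x))).
  by apply: eq_integral => s _; rewrite set_coord0.
Qed.

Definition row_of_tuple n (x : n.-tuple RR) : 'rV[R]_n := \row_i tnth x i.

(** f is the limit of its values at the dyadic points floor(2^k x) / 2^k, and these
    are measurable because each dyadic point is taken on a product of intervals. *)
Lemma continuous_row_measurable n (f : 'rV[R]_n -> R) : continuous f ->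
  measurable_fun setT (fun x : n.-tuple RR => f (row_of_tuple x)).
Proof.
move=> cf.
pose q k (z : {ffun 'I_n -> int}) : 'rV[R]_n := \row_i ((z i)%:~R / 2 ^+ k).
pose fl k (x : n.-tuple RR) : {ffun 'I_n -> int} := [ffun i => Num.floor (2 ^+ k * tnth x i)].
have p2 k : 0 < 2 ^+ k :> R by exact: exprn_gt0.
apply: (@measurable_fun_cvg _ _ _ _ (fun k x => f (q k (fl k x)))) => [k _ B mB|x _].
  rewrite setTI.
  have -> : (fun x => f (q k (fl k x))) @^-1` B =
      \bigcup_(z in [set: {ffun 'I_n -> int}])
        (if f (q k z) \in B then fl k @^-1` [set z] else set0).
    apply/seteqP; split=> x /=.
      by move=> xB; exists (fl k x) => //; rewrite mem_set.
    by move=> [z _]; case: ifPn => // zB /= ->; rewrite inE in zB.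
  apply: countable_bigcupT_measurable; first exact: countableP.
  move=> z; case: ifP => // _.
  have -> : fl k @^-1` [set z] = \bigcap_(i in [set: 'I_n])
      ((fun x : n.-tuple RR => tnth x i) @^-1`
         `[(z i)%:~R / 2 ^+ k, (z i + 1)%:~R / 2 ^+ k[%classic).
    have iff (y : R) c : (Num.floor (2 ^+ k * y) == c) =
        (y \in `[c%:~R / 2 ^+ k, (c + 1)%:~R / 2 ^+ k[).
      rewrite in_itv /= ler_pdivrMr // ltr_pdivlMr // ![y * _]mulrC.
      by apply/eqP/idP => [<-|/floor_def //]; rewrite floor_le_tmp floorD1_gt.
    apply/seteqP; split=> x /=.
      by move=> xz i _ /=; rewrite -iff -xz ffunE.
    move=> H; apply/ffunP => i; rewrite ffunE; apply/eqP; rewrite iff.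
    exact: (H i I).
  apply: fin_bigcap_measurable => [|i _]; first exact: finite_finset.
  by rewrite -[X in measurable X]setTI; apply: measurable_tnth => //; exact: measurable_itv.
apply: continuous_cvg; first exact: cf.
apply/cvg_ballP => e e0.
have [k0 k0e] := geometric_small (@ler01 R) e0.
exists k0 => // k /= k0k; split=> // i j; rewrite /ball /= /row_of_tuple /q /fl !mxE !ffunE.
set y := tnth x j.
have h1 : (Num.floor (2 ^+ k * y))%:~R / 2 ^+ k <= y.
  by rewrite ler_pdivrMr // mulrC floor_le_tmp.
have h2 : y < (Num.floor (2 ^+ k * y))%:~R / 2 ^+ k + (2 ^+ k)^-1.
  rewrite -[X in _ + X]div1r -mulrDl ltr_pdivlMr // mulrC.
  by rewrite -[X in _ + X]/(1%:~R) -intrD floorD1_gt.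
have h3 : (2 ^+ k)^-1 <= 1 / 2 ^+ k0 :> R.
  by rewrite div1r lef_pV2 ?posrE // ler_weXn2l // ler1n.
rewrite ltr_distl; apply/andP; split; lra.
Qed.

End tuple_integrals.

(** * Integrals of partial derivatives *)

Section integrals.
Context (R : realType) (N : nat).
Local Notation RR := (measurableTypeR R).
Local Notation mu := (lebesgue_measure_tuple R N).
Implicit Types (f g F G w phi : 'rV[R]_N -> R) (x : 'rV[R]_N) (i j : 'I_N) (M : R).

Local Notation e_ i := (delta_mx 0 i : 'rV[R]_N).

Definition box_supported f := exists M, forall x, f x != 0 -> forall i, `|x 0 i| <= M.

Definition cont_box f := continuous f /\ box_supported f.

Lemma cont_box_bounded f : cont_box f -> box_bounded (fun p => f (row_of_tuple p)).
Proof.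
move=> [cf [M fM]]; split; first exact: continuous_row_measurable.
pose A := [set v : 'rV[R]_N | forall i, v ord0 i \in `[- `|M|, `|M|]].
have cA : compact A.
  apply: (@rV_compact _ _ (fun=> `[- `|M|, `|M|]%classic)).
  by move=> _; exact: segment_compact.
have A0 : A !=set0.
  by exists 0 => i; rewrite mxE in_itv /= oppr_le0 normr_ge0.
have [|c _ cmax] := @EVT_max_rV R N (fun x => `|f x|) A A0 cA.
  apply: continuous_subspaceT => x; apply: continuous_comp; first exact: cf.
  exact: norm_continuous.
exists M, `|f c|; split=> [x|x /fM H i]; last by have := H i; rewrite mxE.
have [->|fx] := eqVneq (f (row_of_tuple x)) 0; first by rewrite normr0.
apply: cmax; rewrite inE => i; rewrite in_itv /= -ler_norml.
exact: le_trans (fM _ fx i) (ler_norm M).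
Qed.

Lemma cont_box_integrable f : cont_box f ->
  mu.-integrable setT (EFin \o (fun p => f (row_of_tuple p))).
Proof. by move=> /cont_box_bounded; exact: box_bounded_integrable. Qed.

Lemma cont_box_mull f g : cont_box f -> continuous g -> cont_box (fun x => f x * g x).
Proof.
move=> [cf [M fM]] cg; split; first by move=> x; apply: continuousM; [exact: cf|exact: cg].
exists M => x fg; apply: fM; apply: contraNneq fg => ->.
by rewrite mul0r.
Qed.

Lemma cont_box_add f g : cont_box f -> cont_box g -> cont_box (fun x => f x + g x).
Proof.
move=> [cf [M fM]] [cg [M' gM]]; split.
  by move=> x; apply: continuousD; [exact: cf|exact: cg].
exists (Num.max M M') => x fg i; rewrite le_max.
have [f0|/fM ->//] := eqVneq (f x) 0.
by rewrite (gM x) ?orbT //; apply: contraNneq fg => ->; rewrite f0 addr0.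
Qed.

Lemma cont_box_sum (I : Type) (s : seq I) (f : I -> 'rV[R]_N -> R) :
  (forall k, cont_box (f k)) -> cont_box (fun x => \sum_(k <- s) f k x).
Proof.
move=> cf; elim: s => [|k s IH].
  rewrite (_ : (fun _ => _) = fun=> 0); last by apply/funext => x; rewrite big_nil.
  by split; [exact: cst_continuous|exists 0 => x; rewrite eqxx].
rewrite (_ : (fun _ => _) = fun x => f k x + \sum_(l <- s) f l x).
  exact: cont_box_add.
by apply/funext => x; rewrite big_cons.
Qed.

Lemma integral_rV_le f g : cont_box f -> cont_box g -> (forall x, f x <= g x) ->
  integral_rV f <= integral_rV g.
Proof.
move=> cf cg fg; apply: le_Rintegral => //.
- exact: (cont_box_integrable cf).
- exact: (cont_box_integrable cg).
Qed.

Lemma integral_rVD f g : cont_box f -> cont_box g ->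
  integral_rV (fun x => f x + g x) = integral_rV f + integral_rV g.
Proof.
move=> cf cg; apply: RintegralD => //.
- exact: (cont_box_integrable cf).
- exact: (cont_box_integrable cg).
Qed.

Lemma integral_rVZ f (c : R) : cont_box f ->
  integral_rV (fun x => c * f x) = c * integral_rV f.
Proof. by move=> cf; apply: RintegralZl => //; exact: (cont_box_integrable cf). Qed.

Lemma integral_rV_sum0 (I : Type) (s : seq I) (f : I -> 'rV[R]_N -> R) :
  (forall k, cont_box (f k)) -> (forall k, integral_rV (f k) = 0) ->
  integral_rV (fun x => \sum_(k <- s) f k x) = 0.
Proof.
move=> cf f0; elim: s => [|k s IH].
  rewrite (_ : (fun _ => _) = fun x => 0 * 0); last first.
    by apply/funext => x; rewrite big_nil mul0r.
  rewrite integral_rVZ ?mul0r //.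
  by split; [exact: cst_continuous|exists 0 => x; rewrite eqxx].
rewrite (_ : (fun _ => _) = fun x => f k x + \sum_(l <- s) f l x); last first.
  by apply/funext => x; rewrite big_cons.
by rewrite integral_rVD ?f0 ?IH ?addr0 //; exact: cont_box_sum.
Qed.

Lemma box_supported_derive F G i : box_supported F ->
  (forall x, is_derive x (e_ i) F (G x)) -> box_supported G.
Proof.
move=> [M FM] dF; exists M => x Gx j; rewrite leNgt; apply/negP => Mx.
move: Gx; have [_ <-] := dF x.
rewrite (@near_eq_derive _ _ _ F (fun=> 0)) ?derive_cst ?eqxx //.
near=> y; apply/eqP; rewrite -[_ == _]negbK; apply/negP => /FM /(_ j).
apply/negP; rewrite -ltNge; near: y.
have : {for x, continuous (fun y : 'rV[R]_N => `|y 0 j|)}.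
  apply: (@continuous_comp 'rV[R]_N R R (fun y => y 0 j) (fun t => `|t|) x).
    exact: coord_continuous.
  exact: norm_continuous.
by move=> /(_ [set t | M < t]); apply; exact: lt_nbhsr.
Unshelve. all: by end_near. Qed.

Lemma set_coord_row (x : N.-tuple RR) i t :
  row_of_tuple (set_coord x i t) = t *: e_ i + row_of_tuple (set_coord x i 0).
Proof.
apply/rowP => j; rewrite !mxE !tnth_mktuple eqxx /=.
by case: (j == i); rewrite ?mulr1 ?addr0 ?mulr0 ?add0r.
Qed.

(** Fundamental theorem of calculus on the lines parallel to the i-th axis, between
    points outside the support. *)
Lemma integral_rV_derive F G i : box_supported F -> continuous G ->
  (forall x, is_derive x (e_ i) F (G x)) -> cont_box G /\ integral_rV G = 0.
Proof.
move=> sF cG dF; have cbG : cont_box G.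
  by split=> //; exact: box_supported_derive sF dF.
split=> //; rewrite /integral_rV /Rintegral.
rewrite (_ : integral _ _ _ = 0%E) //.
apply: (@integral_coord_zero R N i (fun p => G (row_of_tuple p))).
  exact: cont_box_bounded.
move=> x; have [M FM] := sF; have [_ [M' GM]] := cbG.
pose y := row_of_tuple (set_coord x i 0).
(* The segment [-a, a] is longer than the supports of both F and G. *)
pose a := Num.max `|M| `|M'| + 1.
have a0 : 0 < a by rewrite ltr_wpDl // le_max normr_ge0.
have Ma : M < a.
  by rewrite (le_lt_trans (ler_norm M)) // /a; rewrite (le_lt_trans (_ : _ <= Num.max `|M| `|M'|)) ?ltrDl // le_max lexx.
have Ma' : M' < a.
  by rewrite (le_lt_trans (ler_norm M')) // /a; rewrite (le_lt_trans (_ : _ <= Num.max `|M| `|M'|)) ?ltrDl // le_max lexx orbT.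
have coord t : (t *: e_ i + y) 0 i = t.
  by rewrite !mxE !eqxx mulr1 tnth_mktuple eqxx addr0.
have F0 t : a <= `|t| -> F (t *: e_ i + y) = 0.
  move=> ta; apply/eqP; rewrite -[_ == _]negbK; apply/negP => /FM /(_ i).
  by rewrite coord => /(le_trans ta); rewrite leNgt Ma.
have G0 t : a <= `|t| -> G (t *: e_ i + y) = 0.
  move=> ta; apply/eqP; rewrite -[_ == _]negbK; apply/negP => /GM /(_ i).
  by rewrite coord => /(le_trans ta); rewrite leNgt Ma'.
have dh (t : R) : is_derive t 1 (fun t => F (t *: e_ i + y)) (G (t *: e_ i + y)).
  exact: is_derive_along_affine.
have cl : continuous (fun t : R => t *: e_ i + y).
  move=> t; apply: cvgD; last exact: cvg_cst.
  by apply: cvgZr_tmp; exact: cvg_id.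
transitivity (\int[@lebesgue_measure R]_(t in `[(- a)%R, a]) (G (t *: e_ i + y))%:E)%E.
  rewrite [RHS]integral_mkcond; apply: eq_integral => t _.
  rewrite patchE set_coord_row -/y; case: ifPn => // /negP tN; rewrite G0 //.
  rewrite leNgt; apply/negP => ta; apply: tN; rewrite inE /= in_itv /= -ler_norml.
  exact: ltW.
rewrite (@continuous_FTC2 _ _ (fun t => F (t *: e_ i + y))).
- by rewrite !F0 ?subee // ?normrN ger0_norm // ltW.
- by rewrite gtrN.
- apply: continuous_subspaceT => t.
  by apply: (@continuous_comp R 'rV[R]_N R _ G t); [exact: cl|exact: cG].
- split.
  + by move=> t _; have [] := dh t.
  + by apply: cvg_at_right_filter; exact: is_derive_continuous (dh _).
  + by apply: cvg_at_left_filter; exact: is_derive_continuous (dh _).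
- by move=> t _; rewrite derive1E; have [_ ->] := dh t.
Qed.

End integrals.

(** * Hardy-Rellich inequalities and stability *)

Section hardy_rellich.
Context (R : realType) (N : nat) (eps : R).
Hypothesis eps0 : 0 < eps.
Implicit Types (f g w phi : 'rV[R]_N -> R) (x : 'rV[R]_N) (i j : 'I_N) (k m : nat).

Local Notation e_ i := (delta_mx 0 i : 'rV[R]_N).

(** A smooth substitute for |x|^(-2), so that no singularity has to be cut off. *)
Definition weight x : R := (eps + enorm x ^+ 2)^-1.

Lemma weight_gt0 x : 0 < weight x.
Proof. by rewrite invr_gt0 ltr_wpDr ?sqr_ge0. Qed.

Lemma sqr_enorm_weight_le1 x : enorm x ^+ 2 * weight x <= 1.
Proof. by rewrite ler_pdivrMr ?mul1r ?lerDr ?(ltW eps0) // ltr_wpDr ?sqr_ge0. Qed.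

Lemma is_derive_weight x i :
  is_derive x (e_ i) weight (x 0 i * (- 2 * weight x ^+ 2)).
Proof.
have ev : even_fun (fun y => (eps + y ^+ 2)^-1) by move=> y; rewrite sqrrN.
exact: is_derive_radial (fun y => inverse_quadratic_derive y eps0).
Qed.

Lemma continuous_weight : continuous weight.
Proof.
move=> x; apply: (@continuous_comp 'rV[R]_N R R _ (fun y => (eps + y ^+ 2)^-1) x).
  exact: continuous_enorm.
exact: is_derive_continuous (inverse_quadratic_derive _ eps0).
Qed.

Lemma continuous_exprf f k : continuous f -> continuous (fun x => f x ^+ k).
Proof.
move=> cf x; apply: (@continuous_comp 'rV[R]_N R R f (fun y => y ^+ k) x); first exact: cf.
exact: exprn_continuous.
Qed.

Lemma continuous_mulf f g : continuous f -> continuous g -> continuous (fun x => f x * g x).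
Proof. by move=> cf cg x; apply: continuousM; [exact: cf|exact: cg]. Qed.

Lemma continuous_addf f g : continuous f -> continuous g -> continuous (fun x => f x + g x).
Proof. by move=> cf cg x; apply: continuousD; [exact: cf|exact: cg]. Qed.

Lemma continuous_subf f g : continuous f -> continuous g -> continuous (fun x => f x - g x).
Proof. by move=> cf cg x; apply: continuousB; [exact: cf|exact: cg]. Qed.

Lemma continuous_coordf i : continuous (fun x => x 0 i).
Proof. by move=> x; exact: coord_continuous. Qed.

Lemma continuous_weightX k : continuous (fun x => weight x ^+ k).
Proof. exact/continuous_exprf/continuous_weight. Qed.

Definition smooth_box w := smooth_on setT w /\ box_supported w.

Lemma smooth_box_continuous w : smooth_box w -> continuous w.
Proof. by move=> [sw _] x; exact: smooth_on_continuous sw _. Qed.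

Lemma smooth_box_is_derive w x i : smooth_box w -> is_derive x (e_ i) w (partial i w x).
Proof. by move=> [sw _]; exact: (smooth_on_is_derive i sw I). Qed.

Lemma smooth_box_partial w i : smooth_box w -> smooth_box (partial i w).
Proof.
move=> sw; split; first by case: sw => sw _; exact: smooth_on_partial.
by apply: (box_supported_derive sw.2) => x; exact: smooth_box_is_derive.
Qed.

Lemma smooth_box_cont_box w : smooth_box w -> cont_box w.
Proof. by move=> sw; split; [exact: smooth_box_continuous | exact: sw.2]. Qed.

Lemma smooth_box_laplacian w : smooth_box w -> smooth_box (laplacian w).
Proof.
move=> sw; split; first exact: smooth_on_laplacian openT _ sw.1.
suff [] : cont_box (laplacian w) by [].
apply: cont_box_sum => i.
exact/smooth_box_cont_box/smooth_box_partial/smooth_box_partial.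
Qed.

Lemma smooth_box_iter_laplacian w k : smooth_box w ->
  smooth_box (iter k (@laplacian R N) w).
Proof. by move=> sw; elim: k => // k; exact: smooth_box_laplacian. Qed.

Lemma cont_box_sqr_weight w k : smooth_box w ->
  cont_box (fun x => w x ^+ 2 * weight x ^+ k).
Proof.
move=> sw; rewrite (_ : (fun _ => _) = fun x => w x * (w x * weight x ^+ k)).
  apply: cont_box_mull; first exact: smooth_box_cont_box.
  by apply: continuous_mulf; [exact: smooth_box_continuous | exact: continuous_weightX].
by apply/funext => x; rewrite expr2 mulrA.
Qed.

Lemma divergence_le (A B : 'rV[R]_N -> R)
    (F G : 'I_N -> 'rV[R]_N -> R) : cont_box A -> cont_box B ->
  (forall i, box_supported (F i)) -> (forall i, continuous (G i)) ->
  (forall i x, is_derive x (e_ i) (F i) (G i x)) ->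
  (forall x, A x <= B x + 2 * \sum_i G i x) ->
  integral_rV A <= integral_rV B.
Proof.
move=> cA cB bF cG dF le.
have cbG i := (integral_rV_derive (bF i) (cG i) (dF i)).1.
have cS : cont_box (fun x => \sum_i G i x) by exact: cont_box_sum.
have cS2 : cont_box (fun x => 2 * \sum_i G i x).
  rewrite (_ : (fun _ => _) = fun x => (\sum_i G i x) * 2); last first.
    by apply/funext => x; rewrite mulrC.
  by apply: cont_box_mull => //; exact: cst_continuous.
have := integral_rV_le cA (cont_box_add cB cS2) le.
rewrite integral_rVD // integral_rVZ // integral_rV_sum0 ?mulr0 ?addr0 //.
by move=> i; exact: (integral_rV_derive (bF i) (cG i) (dF i)).2.
Qed.

(** With a = k + 1 and q the weight, half the difference of the integrands is at most
    the divergence of w q^a grad w + a w^2 q^(a+1) x: the coefficient of w^2 q^(a+1)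
    there is at least a (N - 2 a - 2) >= 1, and the term w (Delta w) q^a is absorbed
    by the inequality of arithmetic and geometric means. *)
Lemma rellich_step w k : (2 * k + 5 <= N)%N -> smooth_box w ->
  integral_rV (fun x => w x ^+ 2 * weight x ^+ k.+2) <=
  integral_rV (fun x => laplacian w x ^+ 2 * weight x ^+ k).
Proof.
move=> kN sw; have sp i := smooth_box_partial i sw.
have cw := smooth_box_continuous sw.
have cp i := smooth_box_continuous (sp i).
have cpp i := smooth_box_continuous (smooth_box_partial i (sp i)).
(* Expanding the divergence, the terms in w (d_i w) x_i cancel. *)
pose a : R := k.+1%:R.
pose F i x := w x * (partial i w x * weight x ^+ k.+1 +
   a * (w x * (x 0 i * weight x ^+ k.+2))).
pose G i x := partial i w x ^+ 2 * weight x ^+ k.+1 +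
  w x * partial i (partial i w) x * weight x ^+ k.+1 +
  a * (w x ^+ 2 * weight x ^+ k.+2) -
  2 * a * (a + 1) * (w x ^+ 2 * (x 0 i ^+ 2 * weight x ^+ k.+3)).
have cW n : continuous (fun x => weight x ^+ n) by exact: continuous_weightX.
have cX i : continuous (fun x : 'rV[R]_N => x 0 i) by exact: continuous_coordf.
apply: (@divergence_le _ _ F G).
- exact: cont_box_sqr_weight.
- exact/cont_box_sqr_weight/smooth_box_laplacian.
- move=> i; have [] // : cont_box (F i).
  apply: cont_box_mull; first exact: smooth_box_cont_box.
  apply: continuous_addf; first exact: continuous_mulf.
  apply: continuous_mulf; first exact: cst_continuous.
  by apply: continuous_mulf => //; exact: continuous_mulf.
- move=> i; apply: continuous_subf; last first.
    apply: continuous_mulf; first exact: cst_continuous.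
    apply: continuous_mulf; first exact: continuous_exprf.
    by apply: continuous_mulf => //; exact: continuous_exprf.
  apply: continuous_addf; first apply: continuous_addf.
  + by apply: continuous_mulf => //; exact: continuous_exprf.
  + by apply: continuous_mulf => //; exact: continuous_mulf.
  + apply: continuous_mulf; first exact: cst_continuous.
    by apply: continuous_mulf => //; exact: continuous_exprf.
- move=> i x.
  have dw := smooth_box_is_derive x i sw.
  have dp := smooth_box_is_derive x i (sp i).
  have dX := is_derive_coord x i i; rewrite eqxx in dX.
  have dW n := is_derive_exprn n (is_derive_weight x i).
  have := is_derive_mul dw (is_derive_add (is_derive_mul dp (dW k.+1))
    (is_derive_cmul a (is_derive_mul dw (is_derive_mul dX (dW k.+2))))).
  move=> /is_derive_eq; apply; rewrite /G /= /a !exprS -!natr1; ring.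
move=> x.
have -> : \sum_i G i x = (\sum_i partial i w x ^+ 2) * weight x ^+ k.+1 +
    w x * laplacian w x * weight x ^+ k.+1 +
    N%:R * (a * (w x ^+ 2 * weight x ^+ k.+2)) -
    2 * a * (a + 1) * (w x ^+ 2 * (enorm x ^+ 2 * weight x ^+ k.+3)).
  rewrite /G big_split /= sumrN -mulr_sumr -mulr_sumr -mulr_suml -sqr_enorm.
  rewrite !big_split /= -!mulr_suml -mulr_sumr; congr (_ + _ + _ - _).
  by rewrite sumr_const card_ord -[a *+ N]mulr_natl -mulrA.
have W0 := weight_gt0 x; have W1 := sqr_enorm_weight_le1 x.
have P0 : 0 <= \sum_i partial i w x ^+ 2 by apply: sumr_ge0 => i _; exact: sqr_ge0.
have a1 : 1 <= a by rewrite ler1n.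
have aN : 2 * a + 3 <= N%:R.
  by rewrite /a -(natrM _ 2) -natrD ler_nat; lia.
set X := w x ^+ 2 * weight x ^+ k.+2.
have X0 : 0 <= X by rewrite mulr_ge0 ?sqr_ge0 // exprn_ge0 // ltW.
have E1 : w x ^+ 2 * (enorm x ^+ 2 * weight x ^+ k.+3) = X * (enorm x ^+ 2 * weight x).
  by rewrite /X (exprSr (weight x) k.+2); ring.
have E2 : X * (enorm x ^+ 2 * weight x) <= X by rewrite ler_piMr.
have amgm : 0 <= weight x ^+ k * (w x * weight x + laplacian w x) ^+ 2.
  by rewrite mulr_ge0 ?sqr_ge0 // exprn_ge0 // ltW.
have E3 : weight x ^+ k * (w x * weight x + laplacian w x) ^+ 2 =
    X + laplacian w x ^+ 2 * weight x ^+ k + 2 * (w x * laplacian w x * weight x ^+ k.+1).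
  by rewrite /X !exprS; ring.
have P1 : 0 <= (\sum_i partial i w x ^+ 2) * weight x ^+ k.+1.
  by rewrite mulr_ge0 // exprn_ge0 // ltW.
have E4 : X <= N%:R * (a * X) - 2 * a * (a + 1) * (X * (enorm x ^+ 2 * weight x)).
  have : 2 * a * (a + 1) * (X * (enorm x ^+ 2 * weight x)) <= 2 * a * (a + 1) * X.
    by rewrite ler_wpM2l // !mulr_ge0 // ?addr_ge0 //; lra.
  have : X <= (a * (N%:R - 2 * (a + 1))) * X.
    rewrite ler_peMl // (le_trans a1) // ler_peMr //; lra.
  lra.
rewrite E1; lra.
Qed.

(** Use the divergence of w^2 q x, whose term in w^2 q has coefficient at least
    N - 2 before completing the square with grad w. *)
Lemma hardy_step w : (5 <= N)%N -> smooth_box w ->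
  integral_rV (fun x => w x ^+ 2 * weight x ^+ 1) <=
  integral_rV (fun x => enorm (gradient w x) ^+ 2).
Proof.
move=> N5 sw; have sp i := smooth_box_partial i sw.
have cw := smooth_box_continuous sw.
have cp i := smooth_box_continuous (sp i).
have gradE : (fun x => enorm (gradient w x) ^+ 2) = fun x => \sum_i partial i w x * partial i w x.
  by apply/funext => x; rewrite sqr_enorm; apply: eq_bigr => i _; rewrite mxE expr2.
pose F i x := w x * (2^-1 * (w x * (x 0 i * weight x))).
pose G i x := w x * partial i w x * (x 0 i * weight x) + 2^-1 * (w x ^+ 2 * weight x) -
   w x ^+ 2 * (x 0 i ^+ 2 * weight x ^+ 2).
have cW := continuous_weight.
have cX i : continuous (fun x : 'rV[R]_N => x 0 i) by exact: continuous_coordf.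
rewrite gradE; apply: (@divergence_le _ _ F G).
- exact: cont_box_sqr_weight.
- apply: cont_box_sum => i; apply: cont_box_mull; last exact: cp.
  exact: smooth_box_cont_box.
- move=> i; have [] // : cont_box (F i).
  apply: cont_box_mull; first exact: smooth_box_cont_box.
  apply: continuous_mulf; first exact: cst_continuous.
  by apply: continuous_mulf => //; exact: continuous_mulf.
- move=> i; apply: continuous_subf; first apply: continuous_addf.
  + by apply: continuous_mulf; exact: continuous_mulf.
  + apply: continuous_mulf; first exact: cst_continuous.
    by apply: continuous_mulf => //; exact: continuous_exprf.
  + by apply: continuous_mulf; [|apply: continuous_mulf]; exact: continuous_exprf.
- move=> i x.
  have dw := smooth_box_is_derive x i sw.
  have dX := is_derive_coord x i i; rewrite eqxx in dX.
  have := is_derive_mul dw (is_derive_cmul 2^-1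
    (is_derive_mul dw (is_derive_mul dX (is_derive_weight x i)))).
  move=> /is_derive_eq; apply; rewrite /G /=; by field.
move=> x; rewrite expr1.
have W0 := weight_gt0 x; have W1 := sqr_enorm_weight_le1 x.
set X := w x ^+ 2 * weight x.
have X0 : 0 <= X by rewrite mulr_ge0 ?sqr_ge0 // ltW.
have -> : \sum_i partial i w x * partial i w x + 2 * \sum_i G i x =
    \sum_i (partial i w x + w x * (x 0 i * weight x)) ^+ 2 + N%:R * X -
    3 * (X * (enorm x ^+ 2 * weight x)).
  have -> : 3 * (X * (enorm x ^+ 2 * weight x)) =
      \sum_i 3 * (w x ^+ 2 * (x 0 i ^+ 2 * weight x ^+ 2)).
    rewrite -mulr_sumr -mulr_sumr -mulr_suml -sqr_enorm /X; ring.
  have -> : N%:R * X = \sum_(i < N) X by rewrite sumr_const card_ord mulr_natl.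
  rewrite mulr_sumr -!big_split -sumrB /=; apply: eq_bigr => i _.
  by rewrite /G /X; field.
have S0 : 0 <= \sum_i (partial i w x + w x * (x 0 i * weight x)) ^+ 2.
  by apply: sumr_ge0 => i _; exact: sqr_ge0.
have E2 : X * (enorm x ^+ 2 * weight x) <= X by rewrite ler_piMr.
have NX : 5 * X <= N%:R * X by rewrite ler_wpM2r // ler_nat.
lra.
Qed.

Lemma rellich_iter w n k : (2 * (2 * n + k) < N)%N -> smooth_box w ->
  integral_rV (fun x => w x ^+ 2 * weight x ^+ (2 * n + k)) <=
  integral_rV (fun x => iter n (@laplacian R N) w x ^+ 2 * weight x ^+ k).
Proof.
elim: n w => [|n IH] w nN sw; first by rewrite muln0 add0n.
have -> : (2 * n.+1 + k = (2 * n + k).+2)%N by lia.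
apply: le_trans (rellich_step _ sw) _; first by lia.
rewrite [leRHS](_ : _ = integral_rV (fun x =>
  iter n (@laplacian R N) (laplacian w) x ^+ 2 * weight x ^+ k)).
  by apply: IH; [lia | exact: smooth_box_laplacian].
by congr integral_rV; apply/funext => x; rewrite iterSr.
Qed.

Lemma test_function_smooth_box phi : test_function phi -> smooth_box phi.
Proof.
move=> [sphi cphi]; split=> //.
have [M [_ HM]] := compact_bounded cphi.
exists (M + 1) => x phix i.
have MM : M < M + 1 by rewrite ltrDl.
have cx : closure [set x | phi x != 0] x by exact: subset_closure.
have /= xM := HM (M + 1) MM x cx; apply: le_trans xM.
by rewrite [leRHS]/Num.norm /= mx_normrE; apply/bigmax_geP; right => /=; exists (0, i).
Qed.

Theorem stable_of_weight m (u : 'rV[R]_N -> R) : (2 <= m)%N -> (2 * m < N)%N ->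
  continuous u -> (forall x, expR (u x) <= weight x ^+ m) -> stable m u.
Proof.
move=> m2 mN cu uw phi /test_function_smooth_box sphi.
have cphi := smooth_box_continuous sphi.
have le1 : integral_rV (fun x => expR (u x) * phi x ^+ 2) <=
    integral_rV (fun x => phi x ^+ 2 * weight x ^+ m).
  apply: integral_rV_le => [||x]; last by rewrite mulrC ler_wpM2l ?sqr_ge0.
    rewrite (_ : (fun _ => _) = fun x => phi x * (phi x * expR (u x))).
      apply: cont_box_mull; first exact: smooth_box_cont_box.
      apply: continuous_mulf => // x.
      by apply: (@continuous_comp 'rV[R]_N R R u); [exact: cu | exact: continuous_expR].
    by apply/funext => x; rewrite expr2; ring.
  exact: cont_box_sqr_weight.
have mE := odd_double_half m; case: ifP => om; rewrite om in mE;
  rewrite subr_ge0; apply: (le_trans le1).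
- have mh : (m = 2 * (m.-1)./2 + 1)%N by lia.
  rewrite {1}mh; apply: le_trans (rellich_iter _ sphi) _; first by lia.
  by apply: hardy_step; [lia | exact: smooth_box_iter_laplacian].
- have mh : (m = 2 * m./2 + 0)%N by lia.
  rewrite {1}mh; apply: le_trans (rellich_iter _ sphi) _; first by lia.
  rewrite le_eqVlt; apply/orP; left; apply/eqP; congr integral_rV.
  by apply/funext => x; rewrite expr0 mulr1.
Qed.

End hardy_rellich.

(** * The theorem *)

Unset Implicit Arguments.
Set Strict Implicit.

Theorem theorem1p1 (R : realType) (m N : nat) :
  (2 <= m)%N -> (2 * m < N)%N ->
  forall a : 'I_m.-1 -> R,
  exists beta : R, forall b : R, b <= beta ->
    (exists (T : \bar R) (u : R -> R), @maximal_radial_solution R N m a b T u) /\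
    (forall (T : \bar R) (u : R -> R), @maximal_radial_solution R N m a b T u ->
       T = (+oo)%E /\ stable m (@radial R N u)).
Proof.
move=> m2 mN a.
have m0 : (0 < m)%N := ltnW m2.
have N1 : (1 < N)%N.
  by apply: leq_ltn_trans mN; rewrite muln_gt0 m0.
have s1 : `|(-1) ^+ m| = 1 :> R by rewrite normrX normrN1 expr1n.
have sl : size [seq a i | i <- enum 'I_m.-1] = m.-1.
  by rewrite size_map -cardE card_ord.
have [eps [beta [eps0 profile]]] := global_profile s1 m2 mN sl.
exists beta => b /profile[f [fn fE fdecay]].
have fsol := global_radial_solution (ltnW N1) m0 fn fE.
split.
  exists +oo%E, f; split=> // T v _ Too _.
  by apply/eqP; rewrite -leye_eq.
move=> T u [uT umax].
have uf := radial_solution_unique N1 m0 fn fE uT.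
have Too : T = +oo%E.
  by rewrite -(umax _ f fsol (leey T)) // => r r0 rT; rewrite uf.
split=> //; have -> : @radial R N u = radial f.
  apply/boolp.funext => x; rewrite /radial uf ?enorm_ge0 // Too ltry //.
apply: (stable_of_weight eps0 m2 mN) => [|x].
  exact/radial_algebra_continuous/RadialProfile/(fn 0%N).
by apply: fdecay; exact: enorm_ge0.
Qed.
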